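(* Let $m\ge2$, $1\le l\le m$, $1<p_1,\dots,p_m<\infty$ and $\frac1p=\frac1{p_1}+\cdots+\frac1{p_m}$ with $0<p\le1$. Let $\vec w=(w_1,\dots,w_m)$ be arbitrary weights on $\mathbb R^n$, $\nu_{\vec w}=\prod_{s=1}^mw_s^{p/p_s}$, and let $\vec b=(b_1,\dots,b_l)$ with $b_s\in\mathrm{BMO}_{p_s}(w_s)\cap\mathrm{BMO}$ for $1\le s\le l$. Let $\mathcal T$ be an $m$-linear operator whose iterated commutator $\mathcal T_{\vec b}$ satisfies the sparse domination hypothesis (SD) of the context with constants $C_0,\eta$. Then for all bounded compactly supported $f_1,\dots,f_m$, $$\|\mathcal T_{\vec b}(\vec f)\|_{L^p(\nu_{\vec w})}\le C\,\|\vec b\|^*_{\mathrm{BMO}}\prod_{s=1}^m\|f_s\|_{L^{p_s}(Mw_s)},$$ where $C$ is independent of $\vec w$ and $\vec b$ (it depends only on $n,m,l,p_1,\dots,p_m,C_0,\eta$), and $$\|\vec b\|^*_{\mathrm{BMO}}=\max_{\vec\gamma\in\{1,2\}^l}\Big\{\prod_{s:\gamma_s=1}\|b_s\|_{\mathrm{BMO}_{p_s}(w_s)}\prod_{s:\gamma_s=2}\|b_s\|_{\mathrm{BMO}}\Big\}.$$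
   Context: Cubes have sides parallel to the axes. $\langle g\rangle_Q=\frac1{|Q|}\int_Q g$. $\|b\|_{\mathrm{BMO}}=\sup_Q\langle|b-\langle b\rangle_Q|\rangle_Q$. A weight is a nonnegative locally integrable function; $M$ is the Hardy–Littlewood maximal operator over cubes. For a weight $w$ and $0<q<\infty$, $\mathrm{BMO}_q(w)$ is the set of $f\in L^1_{loc}$ with $\|f\|_{\mathrm{BMO}_q(w)}=\sup_Q\big(\frac1{w(Q)}\int_Q|f-\langle f\rangle_Q|^qw\big)^{1/q}<\infty$ (note $\langle f\rangle_Q$ is the unweighted average). Iterated commutator. For an $m$-linear operator $\mathcal T$ acting on (suitable) functions on $\mathbb R^n$, and $\vec b=(b_1,\dots,b_l)$, set $[\mathcal T,\vec b]_{e_i}(\vec f)(x)=b_i(x)\mathcal T(f_1,\dots,f_m)(x)-\mathcal T(f_1,\dots,b_if_i,\dots,f_m)(x)$ and $\mathcal T_{\vec b}=[\cdots[[\mathcal T,\vec b]_{e_1},\vec b]_{e_2}\cdots,\vec b]_{e_l}$. Dyadic lattice: a collection $\mathcal D$ of cubes such that (i) if $Q\in\mathcal D$ then all dyadic descendants of $Q$ are in $\mathcal D$; (ii) any two $Q_1,Q_2\in\mathcal D$ have a common ancestor in $\mathcal D$; (iii) every compact set is contained in some $Q\in\mathcal D$. A subfamily $\mathcal S$ of a dyadic lattice is $\eta$-sparse, $\eta\in(0,1)$, if $|\bigcup_{P\in\mathcal S,P\subsetneq Q}P|\le(1-\eta)|Q|$ for all $Q\in\mathcal S$. Hypothesis (SD).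 There are constants $C_0>0$, $\eta\in(0,1)$ such that for all bounded compactly supported $f_1,\dots,f_m$ there are $3^n$ $\eta$-sparse families $\mathcal S_1,\dots,\mathcal S_{3^n}$ (each in a dyadic lattice) with, for a.e. $x\in\mathbb R^n$, $$|\mathcal T_{\vec b}(\vec f)(x)|\le C_0\sum_{j=1}^{3^n}\sum_{\vec\gamma\in\{1,2\}^l}\sum_{Q\in\mathcal S_j}\Big(\prod_{s=1}^l\mathcal U(b_s,f_s,Q,\gamma_s)(x)\Big)\Big(\prod_{s=l+1}^m\langle|f_s|\rangle_Q\Big)\chi_Q(x),$$ where $\mathcal U(b,f,Q,1)(x)=|b(x)-\langle b\rangle_Q|\langle|f|\rangle_Q$ and $\mathcal U(b,f,Q,2)(x)=\langle|(b-\langle b\rangle_Q)f|\rangle_Q$. *)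

(* Defs.v *)
From HB Require Import structures.
From mathcomp Require Import all_boot all_order all_algebra.
From mathcomp Require Import all_classical all_reals all_analysis.

Set Implicit Arguments.
Unset Strict Implicit.
Unset Printing Implicit Defensive.

Import Order.TTheory GRing.Theory Num.Theory.
Import numFieldNormedType.Exports.

Local Open Scope classical_set_scope.
Local Open Scope ring_scope.

Section borel_lebesgue.
Context {R : realType}.
Local Notation mR := (measurableTypeR R).

Definition tuple_cons n (x : mR * n.-tuple mR) : n.+1.-tuple mR :=
  [tuple of x.1 :: x.2].

Lemma measurable_tuple_cons n : measurable_fun setT (@tuple_cons n).
Proof. exact: measurable_cons. Qed.

Section successor.
Variables (n : nat) (mu : {sigma_finite_measure set (n.-tuple mR) -> \bar R}).

Definition lebesgue_cons : set (n.+1.-tuple mR) -> \bar R :=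
  pushforward (lebesgue_measure \x mu)%E (@tuple_cons n).

Let lebesgue_cons0 : lebesgue_cons set0 = 0%E.
Proof. by rewrite /lebesgue_cons /pushforward preimage_set0 measure0. Qed.

Let lebesgue_cons_ge0 A : (0 <= lebesgue_cons A)%E.
Proof. exact: (measure_ge0 (lebesgue_measure \x mu)%E). Qed.

Let lebesgue_cons_sigma_additive : semi_sigma_additive lebesgue_cons.
Proof.
pose nu := measure_function_pushforward__canonical__measure_function_Measure
  (lebesgue_measure \x mu)%E (@measurable_tuple_cons n).
exact: (@measure_semi_sigma_additive _ _ _ nu).
Qed.

HB.instance Definition _ := isMeasure.Build _ _ _ lebesgue_cons
  lebesgue_cons0 lebesgue_cons_ge0 lebesgue_cons_sigma_additive.

Let lebesgue_cons_sigma_finite : sigma_finite setT lebesgue_cons.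
Proof.
have /sigma_finiteP[F [FT ndF mF]] := sigma_finiteT (@lebesgue_measure R).
have /sigma_finiteP[G [GT ndG mG]] := sigma_finiteT mu.
pose unc (t : n.+1.-tuple mR) : mR * n.-tuple mR :=
  (tnth t ord0, [tuple of behead t]).
have munc : measurable_fun setT unc.
  by apply: measurable_fun_pair;
    [exact: measurable_tnth|exact: measurable_behead].
have consK : cancel (@tuple_cons n) unc.
  by move=> [x t]; congr pair; exact/val_inj.
exists (fun k => unc @^-1` (F k `*` G k)).
  apply/esym/seteqP; split=> // t _.
  have [i _ Fi] : (\bigcup_k F k) (unc t).1 by rewrite -FT.
  have [j _ Gj] : (\bigcup_k G k) (unc t).2 by rewrite -GT.
  exists (maxn i j) => //; split.
  - by move: Fi; apply/subsetPset/ndF/leq_maxl.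
  - by move: Gj; apply/subsetPset/ndG/leq_maxr.
move=> k; have [mFk Fk] := mF k; have [mGk Gk] := mG k; split.
  by rewrite -[X in measurable X]setTI; apply: munc => //; exact: measurableX.
rewrite /lebesgue_cons /pushforward -comp_preimage.
rewrite (_ : unc \o _ = id); last by apply/funext => x /=; rewrite consK.
by rewrite preimage_id product_measure1E// lte_mul_pinfty// ge0_fin_numE.
Qed.

HB.instance Definition _ := Measure_isSigmaFinite.Build _ _ _ lebesgue_cons
  lebesgue_cons_sigma_finite.

End successor.

Fixpoint borel_lebesgue n : {sigma_finite_measure set (n.-tuple mR) -> \bar R} :=
  match n with
  | 0 => dirac [tuple]
  | n'.+1 => lebesgue_cons (borel_lebesgue n')
  end.

End borel_lebesgue.
Arguments borel_lebesgue R n : clear implicits.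

(* R^n with the sigma-algebra of Lebesgue (not only Borel) measurable sets *)
Definition Rn (R : realType) (n : nat) := 
  @caratheodory_type R (n.-tuple (measurableTypeR R)) ((borel_lebesgue R n)^*)%mu.

HB.instance Definition _ R n := Measurable.on (Rn R n).

Definition lebesgue_Rn (R : realType) (n : nat) : set (Rn R n) -> \bar R :=
  @completed_measure_extension _ _ R (borel_lebesgue R n).

HB.instance Definition _ R n := Measure.on (@lebesgue_Rn R n).

Lemma lebesgue_Rn_sigma_finite (R : realType) n :
  sigma_finite setT (@lebesgue_Rn R n).
Proof. exact/completed_measure_extension_sigma_finite/sigma_finiteT. Qed.

HB.instance Definition _ R n := @Measure_isSigmaFinite.Build _ _ _
  (@lebesgue_Rn R n) (@lebesgue_Rn_sigma_finite R n).

(* [n.-tuple R] carries no topology in the library; that of ['rV[R]_n] is used *)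
Definition rv_of_Rn (R : realType) (n : nat) (x : Rn R n) : 'rV[R]_n :=
  \row_(i < n) tnth x i.

Definition compact_Rn (R : realType) (n : nat) (K : set (Rn R n)) : Prop :=
  compact (@rv_of_Rn R n @` K).

Section function_classes.
Context {R : realType} {n : nat}.
Local Notation mu := (@lebesgue_Rn R n).
Implicit Type f : Rn R n -> R.

Definition bounded_compact_support f : Prop :=
  [/\ measurable_fun setT f,
      exists A : R, forall x, `|f x| <= A &
      compact (closure (@rv_of_Rn R n @` [set x | f x != 0]))].

Definition locally_integrable_Rn f : Prop :=
  measurable_fun setT f /\
  forall K, compact_Rn K -> (\int[mu]_(x in K) `|f x|%:E < +oo)%E.

Definition is_weight f : Prop :=
  (forall x, 0 <= f x) /\ locally_integrable_Rn f.

End function_classes.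

(* (c, r) stands for the half-open cube \prod_i [c_i, c_i + r[ *)
Definition cube (R : realType) (n : nat) : Type := (n.-tuple R * {posnum R})%type.

HB.instance Definition _ R n := Choice.on (cube R n).

Section cubes.
Context {R : realType} {n : nat}.
Implicit Types (Q P : cube R n) (D S : set (cube R n)).
Local Notation mu := (@lebesgue_Rn R n).

Definition side Q : R := Q.2%:num.

Definition cube_set Q : set (Rn R n) :=
  [set x | forall i : 'I_n, tnth Q.1 i <= tnth x i < tnth Q.1 i + side Q].

Definition dyadic_child Q P : Prop :=
  side P = side Q / 2 /\
  exists e : 'I_n -> bool,
    forall i, tnth P.1 i = tnth Q.1 i + (e i)%:R * (side Q / 2).

Inductive dyadic_descendant Q : cube R n -> Prop :=
| dyadic_descendant_refl : dyadic_descendant Q Q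
| dyadic_descendant_child P P' :
    dyadic_descendant Q P -> dyadic_child P P' -> dyadic_descendant Q P'.

Definition dyadic_lattice D : Prop :=
  [/\ forall Q P, D Q -> dyadic_descendant Q P -> D P,
      forall Q1 Q2, D Q1 -> D Q2 ->
        exists Q, [/\ D Q, dyadic_descendant Q Q1 & dyadic_descendant Q Q2] &
      forall K, compact_Rn K -> exists2 Q, D Q & K `<=` cube_set Q].

Definition sparse (eta : R) S : Prop :=
  forall Q, S Q ->
    (mu (\bigcup_(P in [set P | S P /\ cube_set P `<` cube_set Q]) cube_set P)
      <= (1 - eta)%:E * mu (cube_set Q))%E.

Definition sparse_in_lattice (eta : R) S : Prop :=
  sparse eta S /\ exists2 D, dyadic_lattice D & S `<=` D.

Definition avg Q (g : Rn R n -> R) : R :=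
  (fine (mu (cube_set Q)))^-1 * \int[mu]_(x in cube_set Q) g x.

Definition bmo_norm (b : Rn R n -> R) : \bar R :=
  ereal_sup [set (avg Q (fun x => `|b x - avg Q b|))%:E | Q in setT].

Definition BMO (b : Rn R n -> R) : Prop :=
  locally_integrable_Rn b /\ (bmo_norm b < +oo)%E.

(* a cube with w(Q) = 0 contributes 0 *)
Definition wbmo_norm (q : R) (w f : Rn R n -> R) : \bar R :=
  ereal_sup [set ((((fine (\int[mu]_(x in cube_set Q) (w x)%:E))^-1)%:E *
    \int[mu]_(x in cube_set Q) (`|f x - avg Q f| `^ q * w x)%:E) `^ q^-1)%E
    | Q in setT].

Definition wBMO (q : R) (w f : Rn R n -> R) : Prop :=
  locally_integrable_Rn f /\ (wbmo_norm q w f < +oo)%E.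

Definition maximal (g : Rn R n -> R) (x : Rn R n) : \bar R :=
  ereal_sup [set (avg Q (fun y => `|g y|))%:E | Q in [set Q | cube_set Q x]].

(* the (quasi-)norm of L^q(w); the density w may take the value +oo *)
Definition wLnorm (q : R) (w : Rn R n -> \bar R) (g : Rn R n -> R) : \bar R :=
  ((\int[mu]_x ((`|g x| `^ q)%:E * w x)) `^ q^-1)%E.

End cubes.

Section commutators.
Context {R : realType} {n m : nat}.
Local Notation fct := (Rn R n -> R).
Local Notation mu := (@lebesgue_Rn R n).

Definition update (f : 'I_m -> fct) (i : 'I_m) (g : fct) : 'I_m -> fct :=
  fun j => if j == i then g else f j.

(* T is m-linear on D_1 x ... x D_m, with values in the measurable functions
   modulo a.e. equality; T is a total map, unconstrained off that domain. *)
Definition multilinear_on (D : 'I_m -> set fct) (T : ('I_m -> fct) -> fct) : Prop :=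
  [/\ forall s, D s (cst 0),
      forall s (a : R) g h, D s g -> D s h -> D s (fun x => a * g x + h x),
      forall f, (forall s, D s (f s)) -> measurable_fun setT (T f) &
      forall f i (a : R) g h, (forall s, D s (f s)) -> D i g -> D i h ->
        {ae mu, forall x, T (update f i (fun y => a * g y + h y)) x =
                          a * T (update f i g) x + T (update f i h) x}].

Definition commutator (T : ('I_m -> fct) -> fct) (i : 'I_m) (b : fct) :
    ('I_m -> fct) -> fct :=
  fun f x => b x * T f x - T (update f i (fun y => b y * f i y)) x.

Variables (l : nat) (lm : (l <= m)%N).
Local Notation widen := (widen_ord lm).

Definition iterated_commutator (T : ('I_m -> fct) -> fct) (b : 'I_l -> fct) :
    ('I_m -> fct) -> fct :=
  foldl (fun T' i => commutator T' (widen i) (b i)) T (enum 'I_l).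

(* {1,2}^l is encoded by booleans: [true] stands for 1 and [false] for 2 *)
Definition sparse_factor (b f : fct) (Q : cube R n) (gamma : bool) (x : Rn R n) : R :=
  if gamma then `|b x - avg Q b| * avg Q (fun y => `|f y|)
  else avg Q (fun y => `|(b y - avg Q b) * f y|).

Definition sparse_domination (C0 eta : R) (b : 'I_l -> fct)
    (Tb : ('I_m -> fct) -> fct) : Prop :=
  forall f : 'I_m -> fct, (forall s, bounded_compact_support (f s)) ->
  exists S : 'I_(3 ^ n) -> set (cube R n),
    (forall j, sparse_in_lattice eta (S j)) /\
    {ae mu, forall x, (`|Tb f x|%:E <= C0%:E *
      \sum_(j < 3 ^ n) \sum_(gamma : {ffun 'I_l -> bool}) \esum_(Q in S j)
        ((\prod_(s < l) sparse_factor (b s) (f (widen s)) Q (gamma s) x) *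
         (\prod_(s < m | (l <= s)%N) avg Q (fun y => `|f s y|)) *
         \1_(cube_set Q) x)%:E)%E}.

Definition bmo_star (p_ : 'I_m -> R) (w : 'I_m -> fct) (b : 'I_l -> fct) : \bar R :=
  (\big[maxe/-oo]_(gamma : {ffun 'I_l -> bool})
    ((\prod_(s < l | gamma s) wbmo_norm (p_ (widen s)) (w (widen s)) (b s)) *
     (\prod_(s < l | ~~ gamma s) bmo_norm (b s))))%E.

End commutators.

(* Main.v *)
(* Since p <= 1, the p-th power may be taken inside the sparse sum.  On each cube
   Q, Hoelder's inequality with exponents p_s / p and the BMO_{p_s}(w_s) bound
   turn the integral against nu_w into a product of (A_s(Q)^{p_s} w_s(Q))^{p/p_s},
   where A_s(Q) = <|h f_s|>_Q with h = 1 or h = b_s - <b_s>_Q; discrete Hoelder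
   leaves one sum over Q for each s.  As w(Q) = |Q| <w>_Q and <w>_Q <= M_F w on Q,
   where M_F is the maximal operator of the finite family F, the weight is moved
   inside the average: A(Q) <w>_Q^{1/q} <= <|h| g>_Q with g = |f| (M_F w)^{1/q}.
   Hoelder with an exponent r in (1, q) and the John-Nirenberg inequality bound
   this by a multiple of <g^r>_Q^{1/r}, and the Carleson embedding theorem for
   sparse families, applied to g^r with exponent q / r, concludes.

   The maximal inequality behind the embedding is proved for finite families by
   inserting the cubes one at a time, the smallest last.  The John-Nirenberg
   inequality needs no Lebesgue differentiation theorem, only that a set of
   positive measure fills an arbitrarily large proportion of some dyadic cube. *)
Require Import Defs.
From HB Require Import structures.
From mathcomp Require Import all_boot all_order all_algebra.
From mathcomp Require Import all_classical all_reals all_analysis.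
From mathcomp Require Import measurable_realfun measurable_fun_approximation.
From mathcomp Require Import ring lra.

Set Implicit Arguments.
Unset Strict Implicit.
Unset Printing Implicit Defensive.

Import Order.TTheory GRing.Theory Num.Theory.
Import numFieldNormedType.Exports.

Local Open Scope classical_set_scope.
Local Open Scope ring_scope.

(** The weights are arbitrary: no doubling or Muckenhoupt condition compares [w(Q)] with the weight
    of the part of [Q] left uncovered by smaller cubes. Sparseness is therefore usable for Lebesgue
    measure only, and this forces the weight inside an unweighted average before the embedding
    theorem is applied. The two BMO norms reflect the two places of the oscillation. For
    [gamma_s = 1] it stays outside the average and is integrated against the weight, which the norm
    of [BMO_{p_s}(w_s)] controls; for [gamma_s = 2] it sits inside an unweighted average, where only
    moments for Lebesgue measure are needed. The function [maximal w] may be infinite and its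
    measurability is never established. The maximum over a finite family is bounded and measurable,
    and gives way to [maximal w] only in a last comparison of integrals. All bounds are uniform in
    the finite family, so they pass to the whole sparse family through partial sums. *)

Section lower_integral.
Context d (T : measurableType d) (R : realType).
Variable mu : {measure set T -> \bar R}.
Implicit Types f g : T -> \bar R.

(** The integral of a nonnegative function is a supremum over the simple functions below it, so
    enlarging the integrand enlarges the set of competitors. Integrands that contain [maximal w] can
    thus be compared. *)
Lemma le_integral_ge0 f g : (forall x, 0 <= f x)%E -> (forall x, f x <= g x)%E ->
  (\int[mu]_x f x <= \int[mu]_x g x)%E.
Proof.
move=> f0 fg; have g0 x : (0 <= g x)%E by exact: le_trans (f0 x) (fg x).
rewrite !ge0_integralTE//; apply: le_ereal_sup => _ [h hf <-].
by exists h => // x; exact: le_trans (hf x) (fg x).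
Qed.

(** The majorant is raised to [+oo] on the exceptional null set, which keeps it measurable and
    leaves its integral unchanged; the pointwise comparison then applies. *)
Lemma ae_le_integral_ge0 f g : (forall x, 0 <= f x)%E -> (forall x, 0 <= g x)%E ->
  measurable_fun setT g -> {ae mu, forall x, f x <= g x}%E ->
  (\int[mu]_x f x <= \int[mu]_x g x)%E.
Proof.
move=> f0 g0 mg [N [mN muN subN]].
pose h x : \bar R := if x \in N then +oo%E else g x.
have mh : measurable_fun setT h.
  apply: measurable_fun_ifT => //.
  by apply: (measurable_fun_bool true); rewrite setTI preimage_mem_true.
have h0 x : (0 <= h x)%E by rewrite /h; case: ifP.
apply: (@le_trans _ _ (\int[mu]_x h x)%E).
  apply: le_integral_ge0 => // x; rewrite /h; case: ifPn; first by rewrite leey.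
  by rewrite notin_setE => Nx; apply: contrapT => fgx; apply: Nx; exact: subN.
rewrite (@ge0_ae_eq_integral _ _ _ mu setT h g)//.
exists N; split => // x /= /not_implyP[_]; rewrite /h; case: ifPn => //.
by move=> /set_mem.
Qed.

End lower_integral.

(** * Weighted means and Hoelder's inequality with finitely many exponents *)

Section weighted_amgm.
Context (R : realType) (I : finType) (theta : I -> R).
Hypothesis theta_gt0 : forall i, 0 < theta i.
Hypothesis theta_sum : \sum_i theta i = 1.

Lemma prod_powR_expR (P : pred I) (x : I -> R) : (forall i, 0 < x i) ->
  \prod_(i | P i) (x i `^ theta i) = expR (\sum_(i | P i) theta i * ln (x i)).
Proof.
move=> x0; rewrite expR_sum; apply: eq_bigr => i _.
by rewrite /powR gt_eqF.
Qed.

(** Averaging [ln x <= x - 1] with the weights [theta] shows that the logarithm of the product is at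
    most [0]. A vanishing factor is treated apart, the logarithm being used at positive arguments
    only. *)
Lemma weighted_amgm_le1 (x : I -> R) : (forall i, 0 <= x i) ->
  \sum_i theta i * x i <= 1 -> \prod_i x i `^ theta i <= 1.
Proof.
move=> x0 sx; have [[i xi0]|nx] := pselect (exists i, x i = 0).
  by rewrite (bigD1 i)//= xi0 powR0 ?gt_eqF// mul0r.
have {}x0 i : 0 < x i.
  by rewrite lt_neqAle x0 andbT eq_sym; apply/eqP => xi; apply: nx; exists i.
rewrite prod_powR_expR// -[leRHS]expR0 ler_expR.
apply: (@le_trans _ _ (\sum_i theta i * (x i - 1))).
  apply: ler_sum => i _; rewrite ler_pM2l//.
  by rewrite -[X in ln X](subrKC 1) le_ln1Dx// ltrBrDl subrr.
under eq_bigr do rewrite mulrBr mulr1.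
by rewrite sumrB theta_sum subr_le0.
Qed.

(** An empty product is [1], so an index is needed wherever a product has to vanish. *)
Lemma inhabited_index : exists i : I, true.
Proof.
apply: contrapT => /= noI; move: theta_sum; rewrite big1 => [/eqP|i _].
  by rewrite eq_sym oner_eq0.
by case: noI; exists i.
Qed.

Lemma prod_powR_scale (c : R) (y : I -> R) : 0 <= c -> (forall i, 0 <= y i) ->
  \prod_i (c * y i) `^ theta i = c * \prod_i y i `^ theta i.
Proof.
move=> c0 y0; under eq_bigr do rewrite powRM//.
rewrite big_split/=; congr (_ * _).
move: c0; rewrite le_eqVlt => /predU1P[<-|c0].
  have [i _] := inhabited_index.
  by rewrite (bigD1 i)//= powR0 ?gt_eqF// mul0r.
rewrite prod_powR_expR//; under eq_bigr do rewrite mulrC.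
by rewrite -mulr_sumr theta_sum mulr1 lnK.
Qed.

Lemma weighted_amgm (x : I -> R) : (forall i, 0 <= x i) ->
  \prod_i x i `^ theta i <= \sum_i theta i * x i.
Proof.
move=> x0; set A := \sum_i _.
have : 0 <= A by apply: sumr_ge0 => i _; rewrite mulr_ge0// ltW.
rewrite le_eqVlt => /predU1P[A0|A0].
  have [i _] := inhabited_index.
  have /eqP : theta i * x i = 0.
    apply/eqP; rewrite eq_le mulr_ge0 ?(ltW (theta_gt0 _))// andbT A0 /A.
    by rewrite (bigD1 i)//= lerDl sumr_ge0// => k _; rewrite mulr_ge0// ltW.
  rewrite mulf_eq0 gt_eqF//= => /eqP xi.
  by rewrite -A0 (bigD1 i)//= xi powR0 ?gt_eqF// mul0r.
have -> : \prod_i x i `^ theta i = A * \prod_i (A^-1 * x i) `^ theta i.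
  rewrite -prod_powR_scale ?(ltW A0)//; last first.
    by move=> i; rewrite mulr_ge0// invr_ge0 ltW.
  by apply: eq_bigr => i _; rewrite mulVKf// gt_eqF.
rewrite -[leRHS]mulr1 ler_pM2l//; apply: weighted_amgm_le1.
  by move=> i; rewrite mulr_ge0// invr_ge0 ltW.
under eq_bigr do rewrite mulrCA.
by rewrite -mulr_sumr mulVf// gt_eqF.
Qed.

Lemma prod_powR_div (c y : I -> R) : (forall i, 0 < c i) -> (forall i, 0 <= y i) ->
  \prod_i y i `^ theta i =
  \prod_i (c i) `^ theta i * \prod_i (y i / c i) `^ theta i.
Proof.
move=> c0 y0; rewrite -big_split/=; apply: eq_bigr => i _.
rewrite -powRM ?(ltW (c0 _))//; last by rewrite divr_ge0// ltW.
by rewrite mulrC divfK// gt_eqF.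
Qed.

(** Once each row is divided by its total, the arithmetic-geometric mean inequality applies term by
    term, and its right sides add up to [\sum_i theta i = 1]. *)
Lemma holder_sum (J : eqType) (F : seq J) (x : I -> J -> R) :
  (forall i j, 0 <= x i j) ->
  \sum_(j <- F) \prod_i x i j `^ theta i <= \prod_i (\sum_(j <- F) x i j) `^ theta i.
Proof.
move=> x0; set X := fun i => \sum_(j <- F) x i j.
have X0 i : 0 <= X i by apply: sumr_ge0.
have [[i Xi]|nX] := pselect (exists i, X i = 0).
  rewrite big_seq big1 => [|j jF].
    by apply: prodr_ge0 => *; exact: powR_ge0.
  move/eqP: Xi; rewrite /X psumr_eq0// => /allP/(_ _ jF)/eqP xij.
  by rewrite (bigD1 i)//= xij powR0 ?gt_eqF// mul0r.
have {}X0 i : 0 < X i.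
  by rewrite lt_neqAle X0 andbT eq_sym; apply/eqP => Xi; apply: nX; exists i.
under [leLHS]eq_bigr => j _ do rewrite (@prod_powR_div X (x^~ j) X0)//.
rewrite -mulr_sumr -[leRHS]mulr1 ler_wpM2l//.
  by apply: prodr_ge0 => *; exact: powR_ge0.
apply: (@le_trans _ _ (\sum_(j <- F) \sum_i theta i * (x i j / X i))).
  by apply: ler_sum => j _; apply: weighted_amgm => i; rewrite divr_ge0// ltW.
rewrite exchange_big/=; under eq_bigr => i _ do rewrite -mulr_sumr -mulr_suml -/(X i) divff ?gt_eqF// mulr1.
by rewrite theta_sum.
Qed.

Section integral.
Context d (T : measurableType d).
Variable mu : {measure set T -> \bar R}.

(** The argument of [holder_sum] with integrals as totals, which may now also be infinite. *)
Lemma holder_integral (D : set T) (f : I -> T -> R) : measurable D ->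
  (forall i x, D x -> 0 <= f i x) -> (forall i, measurable_fun D (f i)) ->
  (\int[mu]_(x in D) (\prod_i f i x `^ theta i)%:E <=
   \prod_i (\int[mu]_(x in D) (f i x)%:E) `^ theta i)%E.
Proof.
move=> mD f0 mf; set X := fun i => (\int[mu]_(x in D) (f i x)%:E)%E.
have X0 i : (0 <= X i)%E by apply: integral_ge0 => x Dx; rewrite lee_fin f0.
have mEf i : measurable_fun D (fun x => (f i x)%:E) by apply/measurable_EFinP.
have mpw i : measurable_fun D (fun x => f i x `^ theta i).
  by apply: (measurableT_comp (measurable_powR _)).
have mpr : measurable_fun D (fun x => \prod_i f i x `^ theta i).
  by apply: measurable_prod => i _; exact: mpw.
have pr0 x : D x -> 0 <= \prod_i f i x `^ theta i.
  by move=> Dx; apply: prodr_ge0 => i _; exact: powR_ge0.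
have [[i Xi]|nX] := pselect (exists i, X i = 0%E).
  have -> : (\int[mu]_(x in D) (\prod_i f i x `^ theta i)%:E = 0)%E.
    have := (ae_eq_integral_abs mu mD (mEf i)).1.
    under eq_integral => x /set_mem Dx do rewrite gee0_abs ?lee_fin ?f0//.
    move=> /(_ Xi) ae0.
    rewrite (@ge0_ae_eq_integral _ _ _ mu D _ (cst 0%E))//.
    - by rewrite integral0.
    - exact/measurable_EFinP.
    - apply: filterS ae0 => x /= fx Dx; move: (fx Dx) => [fix0].
      by rewrite (bigD1 i)//= fix0 powR0 ?gt_eqF// mul0r.
  by apply: prode_ge0 => k _; exact: poweR_ge0.
have {}X0 i : (0 < X i)%E.
  by rewrite lt_neqAle X0 andbT eq_sym; apply/eqP => Xi; apply: nX; exists i.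
(* Vanishing integrals were removed beforehand: since [0 * +oo = 0], one of them would keep the
   right side from being infinite here. *)
have [[i Xi]|nXy] := pselect (exists i, X i = +oo%E).
  suff -> : (\prod_i X i `^ theta i = +oo)%E by rewrite leey.
  rewrite (bigD1 i)//= Xi poweRyr ?gt_eqF// gt0_mulye//.
  by elim/big_ind : _ => // [? ? ? ?|k _]; [exact: mule_gt0|exact: poweR_gt0].
have Xfin i : X i \is a fin_num.
  by rewrite ge0_fin_numE ?(ltW (X0 _))// ltey; apply/eqP => Xi; apply: nXy; exists i.
pose c i := fine (X i).
have c0 i : 0 < c i by rewrite fine_gt0// X0/= ltey_eq Xfin.
have XE i : X i = (c i)%:E by rewrite fineK.
under [leRHS]eq_bigr => i _ do rewrite -/(X i) XE poweR_EFin.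
rewrite prodEFin.
under eq_integral => x /set_mem Dx.
  rewrite (@prod_powR_div c (f^~ x) c0) ?EFinM; last by move=> i; exact: f0.
  over.
have mdiv i : measurable_fun D (fun x => (f i x / c i) `^ theta i).
  by apply: (measurableT_comp (measurable_powR _)); apply: measurable_funM.
rewrite ge0_integralZl_EFin//; last 3 first.
- by move=> x Dx; rewrite lee_fin; apply: prodr_ge0 => *; exact: powR_ge0.
- apply/measurable_EFinP; apply: measurable_prod => i _; exact: mdiv.
- by apply: prodr_ge0 => *; exact: powR_ge0.
rewrite -[leRHS]mule1 lee_wpmul2l//.
  by rewrite lee_fin; apply: prodr_ge0 => *; exact: powR_ge0.
apply: (@le_trans _ _ (\int[mu]_(x in D) (\sum_i (theta i / c i)%:E * (f i x)%:E))%E).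
  apply: ge0_le_integral => //.
  - by move=> x Dx; rewrite lee_fin; apply: prodr_ge0 => *; exact: powR_ge0.
  - apply/measurable_EFinP; apply: measurable_prod => i _; exact: mdiv.
  - apply: emeasurable_sum => i _; apply: emeasurable_funM => //.
  - move=> x Dx; under [leRHS]eq_bigr do rewrite -EFinM.
    rewrite sumEFin lee_fin.
    under [leRHS]eq_bigr do rewrite mulrAC -mulrA.
    by apply: weighted_amgm => i; rewrite divr_ge0 ?f0// ltW.
rewrite ge0_integral_sum//; last 2 first.
- by move=> i; apply: emeasurable_funM.
- by move=> i x Dx; rewrite -EFinM lee_fin mulr_ge0 ?f0// divr_ge0// ltW.
under eq_bigr => i _.
  rewrite ge0_integralZl_EFin//; last 2 first.
  - by move=> x Dx; rewrite lee_fin f0.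
  - by rewrite divr_ge0// ltW.
  rewrite -/(X i) XE -EFinM divfK ?gt_eqF//.
  over.
by rewrite sumEFin theta_sum.
Qed.

End integral.

End weighted_amgm.

(** * Dyadic cubes *)

Section box.
Context {R : realType}.
Local Notation mR := (measurableTypeR R).

(** The body of [cube_set], read in the Borel sigma-algebra, where the measure is an iterated
    product and can be computed by induction on the dimension. *)
Definition box n (c : n.-tuple R) (s : R) : set (n.-tuple mR) :=
  [set x | forall i : 'I_n, tnth c i <= tnth x i < tnth c i + s].

Lemma measurable_rectangle n (I : 'I_n -> set mR) : (forall i, measurable (I i)) ->
  measurable [set x : n.-tuple mR | forall i, I i (tnth x i)].
Proof.
move=> mI.
have -> : [set x : n.-tuple mR | forall i, I i (tnth x i)] =
    \bigcap_(i in [set: 'I_n]) ((@tnth _ mR ^~ i) @^-1` I i).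
  by apply/seteqP; split => x /= h i; [move=> _; exact: h|exact: h].
apply: fin_bigcap_measurable => // i _.
by rewrite -[X in measurable X]setTI; apply: (measurable_tnth i).
Qed.

Lemma measurable_box n (c : n.-tuple R) (s : R) : measurable (box c s).
Proof.
have -> : box c s = [set x | forall i, `[tnth c i, tnth c i + s[%classic (tnth x i)].
  by apply/seteqP; split => x /= h i; have := h i; rewrite in_itv.
apply: (@measurable_rectangle n (fun i => `[tnth c i, tnth c i + s[%classic)) => i.
exact: measurable_itv.
Qed.

Lemma borel_lebesgue_box n (c : n.-tuple R) (s : R) : 0 < s ->
  borel_lebesgue R n (box c s) = (s ^+ n)%:E.
Proof.
move=> s0; elim: n c => [|n ih] c.
  by rewrite expr0 /= diracE mem_set// => -[i i0]; exfalso; move: i0; rewrite ltn0.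
rewrite /= /lebesgue_cons /pushforward; case/tupleP: c => c0 c.
have -> : @tuple_cons R n @^-1` box [tuple of c0 :: c] s =
    `[c0, c0 + s[%classic `*` box c s.
  apply/seteqP; split => -[x y] /=.
    move=> h; split; first by have := h ord0; rewrite !tnth0 in_itv.
    by move=> i; have := h (lift ord0 i); rewrite !tnthS.
  move=> [+ h] i; rewrite in_itv/= => hx.
  by have [j ->|->] := unliftP ord0 i; rewrite ?tnthS ?tnth0//; exact: h.
rewrite product_measure1E//; last exact: measurable_box.
rewrite ih; transitivity (s%:E * (s ^+ n)%:E)%E; last by rewrite -EFinM -exprS.
congr (_ * _)%E; rewrite [LHS]lebesgue_measure_itv/= lte_fin ltrDl s0 -EFinB.
by rewrite addrAC subrr add0r.
Qed.

End box.

Section cube.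
Context {R : realType} {n : nat}.
Local Notation mu := (@lebesgue_Rn R n).
Implicit Types Q P : cube R n.

Lemma side_gt0 Q : 0 < side Q. Proof. by rewrite /side. Qed.

Lemma measurable_Rn_of_tuple (A : set (n.-tuple (measurableTypeR R))) :
  measurable A -> measurable (A : set (Rn R n)).
Proof. exact: caratheodory_measurable_mu_ext. Qed.

Lemma measurable_cube_set Q : measurable (cube_set Q).
Proof. by apply: measurable_Rn_of_tuple; exact: measurable_box. Qed.

Definition vol Q : R := side Q ^+ n.

Lemma vol_gt0 Q : 0 < vol Q. Proof. by rewrite exprn_gt0// side_gt0. Qed.

Lemma lebesgue_cube Q : mu (cube_set Q) = (vol Q)%:E.
Proof.
rewrite /lebesgue_Rn /completed_measure_extension measurable_mu_extE; last first.
  exact: measurable_box.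
exact/borel_lebesgue_box/side_gt0.
Qed.

Lemma cube_set_corner Q : cube_set Q Q.1.
Proof. by move=> i; rewrite lexx ltrDl side_gt0. Qed.

Definition unit_cube : cube R n := ([tuple 0 | i < n], PosNum (ltr01 : 0 < 1 :> R)).

(** The witness is the closed cube. It makes a locally integrable function integrable on half-open
    cubes. *)
Lemma cube_sub_compact Q : exists K : set (Rn R n),
  [/\ measurable K, compact_Rn K & cube_set Q `<=` K].
Proof.
pose I i := `[tnth Q.1 i, tnth Q.1 i + side Q]%classic.
exists [set x | forall i, I i (tnth x i)]; split.
- apply: measurable_Rn_of_tuple; apply: (@measurable_rectangle R n I) => i.
  exact: measurable_itv.
- rewrite /compact_Rn.
  have -> : @rv_of_Rn R n @` [set x | forall i, I i (tnth x i)] =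
      [set v : 'rV[R]_n | forall i, I i (v ord0 i)].
    apply/seteqP; split => [v [x h <-] i|v h]; first by rewrite mxE; exact: h.
    exists [tuple v ord0 i | i < n]; first by move=> i; rewrite tnth_mktuple; exact: h.
    by apply/rowP => i; rewrite mxE tnth_mktuple.
  by apply: rV_compact => i; exact: segment_compact.
- move=> x h i; rewrite /I/= in_itv/=.
  by have /andP[-> /ltW ->] := h i.
Qed.

Lemma cube_eq Q P : (forall i, tnth Q.1 i = tnth P.1 i) -> side Q = side P -> Q = P.
Proof.
case: Q P => [c r] [c' r'] /= cc' rr'; congr pair; first exact: eq_from_tnth.
exact/val_inj.
Qed.

End cube.

(** * The tree of dyadic descendants of a cube *)

Section dyadic_tree.
Context {R : realType} {n : nat}.
Local Notation E := {ffun 'I_n -> bool}.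
Implicit Types (Q P : cube R n) (e : E) (s t : seq E).

Definition child Q e : cube R n :=
  ([tuple tnth Q.1 i + (e i)%:R * (side Q / 2) | i < n], (Q.2%:num / 2)%:pos).

(** Descendants are addressed by words over [{0,1}^n]. Inclusion becomes the prefix order, and the
    words form a countable type, which provides the countable unions of stopped cubes. *)
Definition offspring Q s : cube R n := foldl child Q s.

Lemma side_child Q e : side (child Q e) = side Q / 2. Proof. by []. Qed.

Lemma tnth_child Q e i :
  tnth (child Q e).1 i = tnth Q.1 i + (e i)%:R * (side Q / 2).
Proof. by rewrite tnth_mktuple. Qed.

Lemma dyadic_childP Q P : dyadic_child Q P <-> exists e, P = child Q e.
Proof.
split=> [[sP [e eP]]|[e ->]]; last by split=> //; exists e => i; rewrite tnth_child.
exists [ffun i => e i]; apply: cube_eq => // i.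
by rewrite tnth_child ffunE.
Qed.

Lemma dyadic_descendantP Q P : dyadic_descendant Q P <-> exists s, P = offspring Q s.
Proof.
split=> [|[s ->]].
  elim=> [|P1 P2 _ [s ->] /dyadic_childP[e ->]]; first by exists [::].
  by exists (rcons s e); rewrite /offspring foldl_rcons.
elim/last_ind: s => [|s e ih]; first exact: dyadic_descendant_refl.
rewrite /offspring foldl_rcons; apply: dyadic_descendant_child ih _.
by apply/dyadic_childP; exists e.
Qed.

Lemma side_offspring Q s : side (offspring Q s) = side Q / 2 ^+ size s.
Proof.
elim: s Q => [|e s ih] Q; first by rewrite expr0 divr1.
by rewrite /= ih side_child exprS invfM mulrA.
Qed.

Lemma offspring_cat Q s t : offspring Q (s ++ t) = offspring (offspring Q s) t.
Proof. exact: foldl_cat. Qed.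

Lemma sub_child Q e : cube_set (child Q e) `<=` cube_set Q.
Proof.
move=> x h i; have := h i; rewrite tnth_child side_child.
have := side_gt0 Q; case: (e i) => /= s0 /andP[h1 h2]; apply/andP; split; lra.
Qed.

Lemma sub_offspring Q s : cube_set (offspring Q s) `<=` cube_set Q.
Proof.
by elim: s Q => [|e s ih] Q //= x /ih; exact: sub_child.
Qed.

Lemma sub_offspring_cat Q s t :
  cube_set (offspring Q (s ++ t)) `<=` cube_set (offspring Q s).
Proof. by rewrite offspring_cat; exact: sub_offspring. Qed.

Lemma child_disjoint Q e e' x :
  cube_set (child Q e) x -> cube_set (child Q e') x -> e = e'.
Proof.
move=> h h'; apply/ffunP => i; have := h i; have := h' i.
have := side_gt0 Q; rewrite !tnth_child !side_child.
case: (e i); case: (e' i) => //= s0 /andP[h1 h2] /andP[h3 h4]; exfalso; lra.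
Qed.

Lemma child_cover Q x : cube_set Q x -> exists e, cube_set (child Q e) x.
Proof.
move=> h; exists [ffun i => tnth Q.1 i + side Q / 2 <= tnth x i] => i.
have /andP[h1 h2] := h i; rewrite tnth_child side_child ffunE.
case: (lerP (tnth Q.1 i + side Q / 2) (tnth x i)) => /= h3; apply/andP; split; lra.
Qed.

Lemma offspring_cover Q N x : cube_set Q x ->
  exists s, size s = N /\ cube_set (offspring Q s) x.
Proof.
elim: N Q => [|N ih] Q Qx; first by exists [::].
have [e ex] := child_cover Qx; have [s [sN sx]] := ih _ ex.
by exists (e :: s); rewrite /= sN.
Qed.

(** Distinct children are disjoint, so two words whose cubes share a point agree letter by
    letter. *)
Lemma offspring_meet Q s t x : (size s <= size t)%N ->
  cube_set (offspring Q s) x -> cube_set (offspring Q t) x ->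
  exists u, t = s ++ u.
Proof.
elim: s t Q => [|e s ih] [|e' t] Q //=; first by exists [::].
  by exists (e' :: t).
rewrite ltnS => st sx tx.
have ee : e = e' by apply: (child_disjoint (sub_offspring sx) (sub_offspring tx)).
move: tx; rewrite -ee => tx; have [u ->] := ih t _ st sx tx.
by exists u.
Qed.

Lemma offspring_meet_eq Q s t x : size s = size t ->
  cube_set (offspring Q s) x -> cube_set (offspring Q t) x -> s = t.
Proof.
move=> st sx tx.
have [|u tE] := @offspring_meet Q s t x _ sx tx; first by rewrite st.
move: st; rewrite tE size_cat => /eqP; rewrite -[X in X == _]addn0 eqn_add2l.
by rewrite eq_sym => /nilP ->; rewrite cats0.
Qed.

End dyadic_tree.

(* Comparing sides rather than generations makes the dichotomy meaningful for
   families that are not contained in the tree of a single cube. *)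
Definition nested (R : realType) (n : nat) (F : set (cube R n)) : Prop :=
  forall P Q, F P -> F Q -> side Q <= side P ->
  cube_set Q `<=` cube_set P \/ cube_set Q `&` cube_set P = set0.

(** * Dyadic lattices: nestedness and countability *)

Section lattice.
Context {R : realType} {n : nat}.
Implicit Types (Q P : cube R n) (D : set (cube R n)).

(** Below a common ancestor both cubes become words, and comparing sides becomes comparing
    lengths. *)
Lemma dyadic_lattice_nested D : dyadic_lattice D -> nested D.
Proof.
move=> [_ anc _] P Q DP DQ QP.
have [A [DA /dyadic_descendantP[s sE] /dyadic_descendantP[t tE]]] := anc _ _ DP DQ.
have st : (size s <= size t)%N.
  move: QP; rewrite sE tE !side_offspring ler_pM2l ?side_gt0//.
  rewrite lef_pV2 ?posrE ?exprn_gt0//.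
  by rewrite ler_eXn2l// ltr1n.
have [|/set0P[x [Qx Px]]] := eqVneq (cube_set Q `&` cube_set P) set0.
  by right.
left; have [u tu] : exists u, t = s ++ u.
  by apply: (@offspring_meet _ _ A s t x) => //; [rewrite -sE|rewrite -tE].
by rewrite sE tE tu; exact: sub_offspring_cat.
Qed.

Lemma sub_cube_eq Q P : cube_set Q `<=` cube_set P -> cube_set P `<=` cube_set Q ->
  side Q = side P -> Q = P.
Proof.
move=> QP PQ sQP; apply: cube_eq => // i; apply/eqP; rewrite eq_le.
have /andP[-> _] := PQ _ (cube_set_corner P) i.
by have /andP[-> _] := QP _ (cube_set_corner Q) i.
Qed.

(** A cube of the lattice is determined by its side and one of its points. The side is [side Q0]
    times a power of two, read off a common ancestor with [Q0], and the point may be taken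
    rational. *)
Lemma dyadic_lattice_countable D : dyadic_lattice D -> countable D.
Proof.
move=> lD; have nD := dyadic_lattice_nested lD; have [_ anc _] := lD.
have [->|/set0P[Q0 DQ0]] := eqVneq D set0; first exact: countable0.
have /choice[f fP] : forall Q, exists abq : nat * nat * n.-tuple rat, D Q ->
    side Q = side Q0 * 2 ^+ abq.1.1 / 2 ^+ abq.1.2 /\
    cube_set Q (map_tuple (fun q => ratr q : R) abq.2).
  move=> Q; have [DQ|nDQ] := pselect (D Q); last by exists (0%N, 0%N, [tuple 0 | i < n]).
  have [A [DA /dyadic_descendantP[s sE] /dyadic_descendantP[t tE]]] := anc _ _ DQ DQ0.
  have /choice[g gP] : forall i, exists q : rat,
      tnth Q.1 i <= ratr q < tnth Q.1 i + side Q.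
    move=> i; have [|q] := @rat_in_itvoo R (tnth Q.1 i) (tnth Q.1 i + side Q).
      by rewrite ltrDl side_gt0.
    by rewrite in_itv/= => /andP[/ltW ? ?]; exists q; apply/andP.
  exists (size t, size s, [tuple g i | i < n]) => _; split => /=.
    rewrite [in LHS]sE tE !side_offspring divfK ?expf_neq0//.
  by move=> i; rewrite tnth_map tnth_mktuple.
apply/countable_injP; exists (pickle \o f) => Q P /set_mem DQ /set_mem DP.
move=> /(pcan_inj pickleK) fQP.
have [sQ xQ] := fP _ DQ; have [sP xP] := fP _ DP.
have sQP : side Q = side P by rewrite sQ sP fQP.
have H A B x : D A -> D B -> side A = side B -> cube_set A x -> cube_set B x ->
    cube_set A `<=` cube_set B.
  move=> DA DB sAB Ax Bx; have [|//|AB] := nD B A DB DA; first by rewrite sAB.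
  by have : (cube_set A `&` cube_set B) x by []; rewrite AB.
rewrite -fQP in xP.
by apply: sub_cube_eq => //; [exact: H xQ xP|exact: H xP xQ].
Qed.

End lattice.

(** * The Carleson embedding theorem for sparse families *)

Section powR_facts.
Context {R : realType}.

(** Young's inequality for [a * b^(t-1)] with exponents [t] and [t/(t-1)], rearranged as a
    comparison of two increments. *)
Lemma powR_increment (t a b : R) : 1 < t -> 0 <= b -> b <= a ->
  a `^ t - b `^ t <= t / (t - 1) * (a `^ t - a * b `^ (t - 1)).
Proof.
move=> t1 b0 ba; have a0 : 0 <= a by exact: le_trans ba.
have t0 : 0 < t by lra.
have t10 : 0 < t - 1 by lra.
have := @conjugate_powR _ a (b `^ (t - 1)) t (t / (t - 1)) a0 (powR_ge0 _ _) t0.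
have q0 : 0 < t / (t - 1) by rewrite divr_gt0.
move=> /(_ q0).
have -> : t^-1 + (t / (t - 1))^-1 = 1 by field; lra.
move=> /(_ erefl); rewrite -powRrM mulrCA divff ?mulr1; last by lra.
move=> young; rewrite mulrBr lerBrDr.
have : t / (t - 1) * (a * b `^ (t - 1)) <=
    t / (t - 1) * (a `^ t / t + b `^ t / (t / (t - 1))) by rewrite ler_pM2l.
have -> : t / (t - 1) * (a `^ t / t + b `^ t / (t / (t - 1))) =
    a `^ t / (t - 1) + b `^ t by field; lra.
have -> : t / (t - 1) * a `^ t = a `^ t + a `^ t / (t - 1) by field; lra.
by move=> *; lra.
Qed.

(** Where [2kg <= m], the left side is at most [m^t / 2]; elsewhere [m] is replaced by [2kg]. The
    half power of [m] is what [ereal_absorb] moves to the other side. *)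
Lemma powR_absorb (t k g m : R) : 1 < t -> 0 < k -> 0 <= g -> 0 <= m ->
  k * (g * m `^ (t - 1)) <= m `^ t / 2 + k * (2 * k) `^ (t - 1) * g `^ t.
Proof.
move=> t1 k0 g0 m0; have t10 : 0 < t - 1 by lra.
have k2 : 0 <= 2 * k by lra.
have [gm|gm] := lerP (2 * k * g) m.
  have : k * g * m `^ (t - 1) <= m / 2 * m `^ (t - 1).
    by rewrite ler_wpM2r ?powR_ge0//; lra.
  have -> : m / 2 * m `^ (t - 1) = m `^ t / 2.
    by rewrite mulrAC mulr_powRB1//; lra.
  rewrite mulrA.
  have : 0 <= k * (2 * k) `^ (t - 1) * g `^ t.
    by rewrite !mulr_ge0// ?powR_ge0// ltW.
  lra.
have : k * g * m `^ (t - 1) <= k * g * (2 * k * g) `^ (t - 1).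
  rewrite ler_wpM2l ?mulr_ge0 ?(ltW k0)// ge0_ler_powR ?nnegrE ?(ltW t10) ?(ltW gm)//.
  by rewrite mulr_ge0.
have -> : k * g * (2 * k * g) `^ (t - 1) = k * (2 * k) `^ (t - 1) * g `^ t.
  by rewrite powRM// mulrACA mulr_powRB1//; lra.
have : 0 <= m `^ t by exact: powR_ge0.
by rewrite mulrA; lra.
Qed.

Lemma ler_sum_powR_max (a b t : R) : 0 <= a -> 0 <= b ->
  (Num.max a b) `^ t <= a `^ t + b `^ t.
Proof.
by move=> a0 b0; case: (leP a b) => _; [rewrite lerDr|rewrite lerDl]; exact: powR_ge0.
Qed.

(** Half of [i] is subtracted from both sides, which is legitimate because [i] is finite. *)
Lemma ereal_absorb (i z : \bar R) (c : R) : 0 < c -> (0 <= i < +oo)%E ->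
  (0 <= z)%E -> (i <= 2^-1%:E * i + (2^-1 * c)%:E * z -> i <= c%:E * z)%E.
Proof.
move=> c0 /andP[i0 ioo] z0.
have : i \is a fin_num by rewrite ge0_fin_numE.
case: i i0 ioo => [i| |]// _ _ _.
case: z z0 => [z| |]// _; first by rewrite -!EFinM -EFinD !lee_fin; lra.
by move=> _; rewrite gt0_muley ?lte_fin// leey.
Qed.

End powR_facts.

Section real_integrands.
Context d (T : measurableType d) (R : realType).
Variable mu : {measure set T -> \bar R}.

Lemma measurable_scaled_indic (D A : set T) (c : R) : measurable A ->
  measurable_fun D (fun x => (c * \1_A x)%:E).
Proof.
move=> mA; apply/measurable_EFinP; apply: measurable_funM => //.
Qed.

Lemma ge0_RintegralZl (D : set T) (f : T -> R) (k : R) : measurable D ->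
  measurable_fun D f -> (forall x, D x -> 0 <= f x) -> 0 <= k ->
  (\int[mu]_(x in D) (k * f x)%:E = k%:E * \int[mu]_(x in D) (f x)%:E)%E.
Proof.
move=> mD mf f0 k0; under eq_integral do rewrite EFinM.
by rewrite ge0_integralZl_EFin//; exact/measurable_EFinP.
Qed.

Lemma integral_scaled_indic (D A : set T) (c : R) : 0 <= c -> measurable D ->
  measurable A -> A `<=` D ->
  (\int[mu]_(x in D) (c * \1_A x)%:E = c%:E * mu A)%E.
Proof.
move=> c0 mD mA AD; rewrite ge0_RintegralZl//.
by rewrite integral_indic// setIidl.
Qed.

Lemma ge0_RintegralD (D : set T) (f g : T -> R) : measurable D ->
  measurable_fun D f -> measurable_fun D g ->
  (forall x, D x -> 0 <= f x) -> (forall x, D x -> 0 <= g x) ->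
  (\int[mu]_(x in D) (f x + g x)%:E =
   \int[mu]_(x in D) (f x)%:E + \int[mu]_(x in D) (g x)%:E)%E.
Proof.
move=> mD mf mg f0 g0; under eq_integral do rewrite EFinD.
by rewrite ge0_integralD//; exact/measurable_EFinP.
Qed.

Lemma ge0_le_Rintegral (D : set T) (f g : T -> R) : measurable D ->
  measurable_fun D f -> measurable_fun D g ->
  (forall x, D x -> 0 <= f x) -> (forall x, D x -> f x <= g x) ->
  (\int[mu]_(x in D) (f x)%:E <= \int[mu]_(x in D) (g x)%:E)%E.
Proof.
by move=> mD mf mg f0 g0; apply: ge0_le_integral => //; exact/measurable_EFinP.
Qed.

End real_integrands.

Section averages.
Context {R : realType} {n : nat}.
Local Notation mu := (@lebesgue_Rn R n).
Implicit Types (Q P : cube R n) (F : seq (cube R n)) (G : Rn R n -> R).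

Lemma fine_lebesgue_cube Q : fine (mu (cube_set Q)) = vol Q.
Proof. by rewrite lebesgue_cube. Qed.

Lemma measure_cube Q :
  (mu : {measure set (Rn R n) -> \bar R}) (cube_set Q) = (vol Q)%:E.
Proof. exact: lebesgue_cube. Qed.

Lemma avg_ge0 Q G : (forall x, cube_set Q x -> 0 <= G x) -> 0 <= avg Q G.
Proof.
move=> G0; rewrite /avg fine_lebesgue_cube mulr_ge0 ?invr_ge0 ?(ltW (vol_gt0 _))//.
by apply: Rintegral_ge0.
Qed.

Lemma avg_integral Q G : mu.-integrable (cube_set Q) (EFin \o G) ->
  (\int[mu]_(x in cube_set Q) (G x)%:E = (vol Q * avg Q G)%:E)%E.
Proof.
move=> iG; rewrite /avg fine_lebesgue_cube mulVKf ?gt_eqF ?vol_gt0//.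
by rewrite /Rintegral fineK//; apply: integrable_fin_num => //; exact: measurable_cube_set.
Qed.

Lemma ge0_integral_split (D : set (Rn R n)) (f : Rn R n -> \bar R) : measurable D ->
  measurable_fun setT f -> (forall x, 0 <= f x)%E ->
  (\int[mu]_x f x = \int[mu]_(x in ~` D) f x + \int[mu]_(x in D) f x)%E.
Proof.
move=> mD mf f0; rewrite -[in LHS](setvU D) ge0_integral_setU//.
- exact: measurableC.
- by rewrite setvU.
- by apply/disj_setPS => x [].
Qed.

Definition avg_max F G (x : Rn R n) : R :=
  \big[Num.max/0]_(Q <- F) (avg Q G * \1_(cube_set Q) x).

Lemma avg_max_cons Q F G x :
  avg_max (Q :: F) G x = Num.max (avg Q G * \1_(cube_set Q) x) (avg_max F G x).
Proof. by rewrite /avg_max big_cons. Qed.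

Lemma avg_max_ge0 F G x : 0 <= avg_max F G x.
Proof.
elim: F => [|Q F ih]; first by rewrite /avg_max big_nil.
by rewrite avg_max_cons le_max ih orbT.
Qed.

Lemma measurable_avg_max F G : measurable_fun setT (avg_max F G).
Proof.
elim: F => [|Q F ih].
  rewrite (_ : avg_max _ _ = cst 0)//.
  by apply/funext => x; rewrite /avg_max big_nil.
rewrite (_ : avg_max _ _ = fun x =>
    Num.max (avg Q G * \1_(cube_set Q) x) (avg_max F G x)); last first.
  by apply/funext => x; rewrite avg_max_cons.
apply: measurable_maxr; last exact: ih.
apply: measurable_funM; first exact: measurable_cst.
exact/measurable_indic/measurable_cube_set.
Qed.

Lemma avg_max_le F G x Q : Q \in F -> cube_set Q x -> avg Q G <= avg_max F G x.
Proof.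
elim: F => // P F ih; rewrite inE avg_max_cons le_max => /predU1P[<- Qx|QF Qx].
  by rewrite indicE mem_set// mulr1 lexx.
by rewrite ih// orbT.
Qed.

(* The cubes of [F] that meet [Q] contain it. *)
Lemma avg_max_cst Q F G x y : nested [set` Q :: F] ->
  (forall P, P \in F -> side Q <= side P) -> cube_set Q x -> cube_set Q y ->
  avg_max F G x = avg_max F G y.
Proof.
move=> nF sF Qx Qy; rewrite /avg_max big_seq [RHS]big_seq.
apply: eq_bigr => P PF; rewrite !indicE.
have [||QP|QP] := nF P Q _ _ (sF _ PF); [by rewrite /= inE PF orbT|by rewrite /= inE eqxx|..].
  by rewrite !mem_set//; exact: QP.
rewrite !memNset// => Px.
  by have : (cube_set Q `&` cube_set P) y by []; rewrite QP.
by have : (cube_set Q `&` cube_set P) x by []; rewrite QP.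
Qed.

(** * The maximal inequality for a finite nested family *)

Section maximal_theorem.
Variables (t : R) (t1 : 1 < t) (G : Rn R n -> R).
Hypothesis mG : measurable_fun setT G.
Hypothesis G0 : forall x, 0 <= G x.
Hypothesis iG : forall Q, mu.-integrable (cube_set Q) (EFin \o G).

Let t10 : 0 < t - 1. Proof. by rewrite subr_gt0. Qed.
Let t_gt0 : 0 < t. Proof. exact: lt_trans t1. Qed.
Let avgG0 Q : 0 <= avg Q G. Proof. exact: avg_ge0. Qed.

Let mMr F r : measurable_fun setT (fun x => avg_max F G x `^ r).
Proof.
by apply: (measurableT_comp (measurable_powR _)); exact: measurable_avg_max.
Qed.

Let mMt F r : measurable_fun setT (fun x => (avg_max F G x `^ r)%:E).
Proof. by apply/measurable_EFinP; exact: mMr. Qed.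

Let mGMr F r : measurable_fun setT (fun x => G x * avg_max F G x `^ r).
Proof. by apply: measurable_funM; [exact: mG|exact: mMr]. Qed.

Let mGM F r : measurable_fun setT (fun x => (G x * avg_max F G x `^ r)%:E).
Proof. by apply/measurable_EFinP; exact: mGMr. Qed.

(** Supplies the finiteness that absorption requires. *)
Lemma avg_max_powR_lty F : (\int[mu]_x (avg_max F G x `^ t)%:E < +oo)%E.
Proof.
elim: F => [|Q F ih].
  rewrite integral0_eq// => x _.
  by rewrite /avg_max big_nil powR0// gt_eqF.
have mQ := measurable_cube_set Q.
apply: (@le_lt_trans _ _ (\int[mu]_x (((avg Q G) `^ t * \1_(cube_set Q) x)%:E +
   (avg_max F G x `^ t)%:E))%E).
  apply: le_integral_ge0 => x; first by rewrite lee_fin powR_ge0.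
  rewrite avg_max_cons -EFinD lee_fin.
  rewrite (le_trans (ler_sum_powR_max _ _ _))//; [by rewrite mulr_ge0|exact: avg_max_ge0|].
  rewrite lerD2r powRM// indicE; case: (_ \in _) => /=.
    by rewrite powR1.
  by rewrite powR0// gt_eqF.
rewrite ge0_integralD; last 5 first.
- exact: measurableT.
- by move=> x _; rewrite lee_fin mulr_ge0// powR_ge0.
- exact: measurable_scaled_indic.
- by move=> x _; rewrite lee_fin powR_ge0.
- exact: mMt.
rewrite lte_add_pinfty// integral_scaled_indic ?powR_ge0//.
by rewrite measure_cube -EFinM ltry.
Qed.

(** A discrete form of the argument for Doob's inequality, with Doob's constant [t/(t-1)]. In the
    sorted list the head is the smallest cube, so the maximal function of the tail is constant on
    it. *)
Lemma avg_max_step F : sorted (fun P Q => side P <= side Q) F -> nested [set` F] ->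
  (\int[mu]_x (avg_max F G x `^ t)%:E <=
   (t / (t - 1))%:E * \int[mu]_x (G x * avg_max F G x `^ (t - 1))%:E)%E.
Proof.
have k0 : 0 <= t / (t - 1) by rewrite divr_ge0 ?ltW.
elim: F => [_ _|Q F ih sQF nQF].
  rewrite [leLHS]integral0_eq => [|x _]; last first.
    by rewrite /avg_max big_nil powR0// gt_eqF.
  rewrite mule_ge0 ?lee_fin//; apply: integral_ge0 => x _.
  by rewrite lee_fin mulr_ge0// powR_ge0.
have nF : nested [set` F].
  by move=> P1 P2 /= P1F P2F; apply: nQF; rewrite /= inE (P1F, P2F) orbT.
have sF : sorted (fun P Q => side P <= side Q) F by exact: path_sorted sQF.
have minQ P : P \in F -> side Q <= side P.
  move: sQF; rewrite /= path_sortedE; last by move=> ? ? ?; exact: le_trans.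
  by move=> /andP[/allP + _]; exact.
have {}ih := ih sF nF.
have mQ := measurable_cube_set Q.
(* [m] is read off at the corner of [Q] and is the value on all of [Q]. *)
set lam := avg Q G; pose m := avg_max F G Q.1.
have mE x : cube_set Q x -> avg_max F G x = m.
  by move=> Qx; apply: (avg_max_cst _ nQF) => //; exact: cube_set_corner.
have offQ x : ~ cube_set Q x -> avg_max (Q :: F) G x = avg_max F G x.
  move=> nQx; rewrite avg_max_cons indicE memNset// mulr0.
  by apply/max_idPr; exact: avg_max_ge0.
have onQ x : cube_set Q x -> avg_max (Q :: F) G x = Num.max lam m.
  by move=> Qx; rewrite avg_max_cons indicE mem_set// mulr1 mE.
have [lm|ml] := leP lam m.
  suff -> : avg_max (Q :: F) G = avg_max F G by [].
  apply/funext => x; have [Qx|nQx] := pselect (cube_set Q x); last exact: offQ.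
  by rewrite onQ// mE//; exact/max_idPr.
have m0 : 0 <= m by exact: avg_max_ge0.
(* Both sides change on [Q] only, where the maximal function jumps from [m] to
   [lam]; [powR_increment] compares the two jumps. *)
have MQ (F' : seq (cube R n)) (c r : R) : 0 <= c ->
   (forall x, cube_set Q x -> avg_max F' G x = c) ->
   (\int[mu]_(x in cube_set Q) (avg_max F' G x `^ r)%:E = (c `^ r * vol Q)%:E)%E /\
   (\int[mu]_(x in cube_set Q) (G x * avg_max F' G x `^ r)%:E =
     (c `^ r * (vol Q * lam))%:E)%E.
  move=> c0 cE; split.
    under eq_integral => x /set_mem Qx do rewrite cE//.
    by rewrite integral_cst// measure_cube EFinM.
  under eq_integral => x /set_mem Qx do rewrite cE// mulrC.
  rewrite ge0_RintegralZl ?powR_ge0//; last exact: measurable_funTS.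
  by rewrite avg_integral// EFinM.
have onQ' x : cube_set Q x -> avg_max (Q :: F) G x = lam.
  by move=> Qx; rewrite onQ//; apply/max_idPl; exact: ltW.
have M0 F' r x : (0 <= (avg_max F' G x `^ r)%:E)%E by rewrite lee_fin powR_ge0.
have E1 F' r := @ge0_integral_split (cube_set Q) _ mQ (mMt F' r) (M0 F' r).
have GM0 F' r x : (0 <= (G x * avg_max F' G x `^ r)%:E)%E.
  by rewrite lee_fin mulr_ge0// powR_ge0.
have E2 F' r := @ge0_integral_split (cube_set Q) _ mQ (mGM F' r) (GM0 F' r).
have [A1 A2] := MQ F m t m0 mE; have [_ A3] := MQ F m (t - 1) m0 mE.
have [B1 _] := MQ (Q :: F) lam t (avgG0 Q) onQ'.
have [_ B3] := MQ (Q :: F) lam (t - 1) (avgG0 Q) onQ'.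
rewrite !E1 !E2 A1 A3 in ih *; rewrite B1 B3.
rewrite (@eq_integral _ _ _ mu (~` cube_set Q) (fun x => (avg_max F G x `^ t)%:E)
  (fun x => (avg_max (Q :: F) G x `^ t)%:E)); last first.
  by move=> x /set_mem Qx; rewrite offQ.
rewrite [in leRHS](@eq_integral _ _ _ mu (~` cube_set Q) (fun x => (G x * avg_max F G x `^ (t - 1))%:E)
  (fun x => (G x * avg_max (Q :: F) G x `^ (t - 1))%:E)); last first.
  by move=> x /set_mem Qx; rewrite offQ.
set a := (\int[mu]_(x in _) (avg_max F G x `^ t)%:E)%E in ih *.
set b := (\int[mu]_(x in _) (G x * avg_max F G x `^ (t - 1))%:E)%E in ih *.
have inc : (lam `^ t - m `^ t) * vol Q <=
    t / (t - 1) * (lam `^ t - lam * m `^ (t - 1)) * vol Q.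
  rewrite ler_wpM2r ?(ltW (vol_gt0 _))//; apply: powR_increment => //; exact: ltW.
have b0 : (0 <= b)%E by apply: integral_ge0 => x _; exact: GM0.
have -> : (a + (lam `^ t * vol Q)%:E =
    (a + (m `^ t * vol Q)%:E) + ((lam `^ t - m `^ t) * vol Q)%:E)%E.
  by rewrite -addeA -EFinD; congr (_ + _%:E)%E; ring.
apply: (le_trans (leeD ih (_ : (_ <= (t / (t - 1) * (lam `^ t - lam * m `^ (t - 1)) * vol Q)%:E)%E))).
  by rewrite lee_fin.
have mQ0 r l : 0 <= l -> (0 <= (r `^ (t - 1) * (vol Q * l))%:E)%E.
  by move=> l0; rewrite lee_fin !mulr_ge0 ?powR_ge0// ltW// vol_gt0.
rewrite !(ge0_muleDr _ b0) ?mQ0 ?avgG0//.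
rewrite -addeA leeD2l// -!EFinM -EFinD lee_fin.
rewrite -(@mulr_powRB1 _ lam t) ?(avgG0 Q)//.
by rewrite le_eqVlt; apply/orP; left; apply/eqP; ring.
Qed.

(** Twice the constant of [powR_absorb] for [k = t/(t-1)]; the factor two pays for the
    absorption. *)
Definition maximal_const : R := 2 * (t / (t - 1) * (2 * (t / (t - 1))) `^ (t - 1)).

Lemma maximal_const_gt0 : 0 < maximal_const.
Proof.
have k0 : 0 < t / (t - 1) by rewrite divr_gt0.
by rewrite /maximal_const mulr_gt0// mulr_gt0// powR_gt0// mulr_gt0.
Qed.

Lemma dyadic_maximal F : sorted (fun P Q => side P <= side Q) F -> nested [set` F] ->
  (\int[mu]_x (avg_max F G x `^ t)%:E <= maximal_const%:E * \int[mu]_x (G x `^ t)%:E)%E.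
Proof.
move=> sF nF; have := avg_max_step sF nF; have := avg_max_powR_lty F.
set I := (X in (X < +oo)%E); set J := (X in (_ * X)%E) => Ifin IJ.
have k0 : 0 < t / (t - 1) by rewrite divr_gt0.
have mGt : measurable_fun setT (fun x => G x `^ t).
  exact: (measurableT_comp (measurable_powR _)).
have I0 : (0 <= I)%E by apply: integral_ge0 => x _; rewrite lee_fin powR_ge0.
have : ((t / (t - 1))%:E * J <= 2^-1%:E * I + 2^-1%:E * maximal_const%:E * \int[mu]_x (G x `^ t)%:E)%E.
  rewrite -EFinM.
  have kk0 : 0 <= 2^-1 * maximal_const by rewrite mulr_ge0// ltW// maximal_const_gt0.
  rewrite -(ge0_RintegralZl _ measurableT (mGMr F (t - 1)) _ (ltW k0)); last first.
    by move=> x _; rewrite mulr_ge0 ?powR_ge0.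
  rewrite -(ge0_RintegralZl _ measurableT (mMr F t)) ?invr_ge0//; last first.
    by move=> x _; exact: powR_ge0.
  rewrite -(ge0_RintegralZl _ measurableT mGt _ kk0); last first.
    by move=> x _; exact: powR_ge0.
  rewrite -ge0_RintegralD; last 5 first.
  - exact: measurableT.
  - by apply: measurable_funM; [exact: measurable_cst|exact: mMr].
  - by apply: measurable_funM; [exact: measurable_cst|exact: mGt].
  - by move=> x _; rewrite mulr_ge0 ?powR_ge0.
  - by move=> x _; rewrite mulr_ge0 ?powR_ge0.
  apply: le_integral_ge0 => x.
    by rewrite lee_fin mulr_ge0 ?(ltW k0)// mulr_ge0// powR_ge0.
  rewrite lee_fin (le_trans (powR_absorb t1 k0 (G0 x) (avg_max_ge0 F G x)))//.
  by rewrite /maximal_const mulKf// mulrC.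
move=> /(le_trans IJ); apply: ereal_absorb.
- exact: maximal_const_gt0.
- by rewrite I0 Ifin.
- by apply: integral_ge0 => x _; rewrite lee_fin powR_ge0.
Qed.

End maximal_theorem.

(* Sparseness turns [vol Q] into the measure of the part of [Q] that the smaller
   cubes leave uncovered, and these parts are disjoint. *)
Section carleson.
Variables (t eta : R) (t1 : 1 < t) (eta0 : 0 < eta) (G : Rn R n -> R).
Hypothesis mG : measurable_fun setT G.
Hypothesis G0 : forall x, 0 <= G x.
Hypothesis iG : forall Q, mu.-integrable (cube_set Q) (EFin \o G).

(** In positive dimension the volume determines the side. In dimension [0] all cubes are the same
    point. *)
Lemma cube_set_inj : (0 < n)%N -> injective (@cube_set R n).
Proof.
move=> n0 P Q PQ; apply: sub_cube_eq; rewrite ?PQ//.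
have : vol P = vol Q by apply: EFin_inj; rewrite -!lebesgue_cube PQ.
by move/eqP; rewrite /vol eqrXn2 ?ltW ?side_gt0// => /eqP.
Qed.

Lemma carleson_sorted F : (0 < n)%N -> sorted (fun P Q => side P <= side Q) F ->
  nested [set` F] -> uniq F -> sparse eta [set` F] ->
  ((\sum_(Q <- F) vol Q * avg Q G `^ t)%:E <=
   (eta^-1 * maximal_const t)%:E * \int[mu]_x (G x `^ t)%:E)%E.
Proof.
move=> n0 sF nF uF spF.
pose U Q := \bigcup_(P in [set P | P \in F /\ cube_set P `<` cube_set Q]) cube_set P.
pose E Q := cube_set Q `\` U Q.
have mU Q : measurable (U Q).
  apply: fin_bigcup_measurable; last by move=> P _; exact: measurable_cube_set.
  apply: (@sub_finite_set _ _ [set` F]); first by move=> P [].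
  exact: finite_seq.
have mE Q : measurable (E Q) by apply: measurableD => //; exact: measurable_cube_set.
have volE Q : Q \in F -> ((vol Q)%:E <= eta^-1%:E * mu (E Q))%E.
  move=> QF; have : (mu (cube_set Q) <= mu (E Q) + mu (U Q))%E.
    apply: (le_trans _ (measureU2 _ (mE Q) (mU Q))).
    apply: le_measure; rewrite ?inE//; [exact: measurable_cube_set|exact: measurableU|].
    by move=> x Qx; have [Ux|nUx] := pselect (U Q x); [right|left].
  move=> /le_trans/(_ (leeD2l _ (spF Q QF))); rewrite lebesgue_cube -EFinM.
  have : (0 <= mu (E Q))%E by exact: measure_ge0.
  case: (mu (E Q)) => [e| |]// e0; last by rewrite gt0_muley ?leey// lte_fin invr_gt0.
  rewrite -EFinD -EFinM !lee_fin => h.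
  by rewrite ler_pdivlMl//; lra.
(* Two cubes of [F] sharing a point are nested; if they differ, the smaller one is a strict subset
   and was removed from the larger. *)
have disj P Q x : P \in F -> Q \in F -> E P x -> E Q x -> P = Q.
  wlog PQ : P Q / side P <= side Q.
    move=> W PF QF EP EQ; have [PQ|/ltW QP] := leP (side P) (side Q); first exact: W.
    by apply/esym; exact: W.
  move=> PF QF [Px nUP] [Qx nUQ]; have [PsubQ|PQ0] := nF Q P QF PF PQ; last first.
    by have : (cube_set P `&` cube_set Q) x by []; rewrite PQ0.
  apply: cube_set_inj => //; apply/seteqP; split => //.
  by apply: contrapT => nQP; apply: nUQ; exists P.
(* At most one of the disjoint parts contains [x], so a single term survives. *)
have sumM x : \sum_(Q <- F) avg Q G `^ t * \1_(E Q) x <= avg_max F G x `^ t.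
  have [[Q [QF Ex]]|nE] := pselect (exists Q, Q \in F /\ E Q x); last first.
    rewrite big_seq big1 ?powR_ge0// => Q QF.
    by rewrite indicE memNset ?mulr0// => EQ; apply: nE; exists Q.
  rewrite (bigD1_seq Q)//= big_seq_cond big1 => [|P /andP[PF PQ]].
    rewrite addr0 indicE mem_set// mulr1 ge0_ler_powR ?nnegrE ?avg_ge0 ?avg_max_ge0 ?(ltW (lt_trans _ t1))//.
    by apply: avg_max_le => //; exact: Ex.1.
  rewrite indicE memNset ?mulr0// => EP; move/eqP: PQ; apply.
  exact: disj EP Ex.
have l0 Q : 0 <= avg Q G `^ t by exact: powR_ge0.
have ei : 0 <= eta^-1 by rewrite invr_ge0 ltW.
rewrite EFinM -muleA; apply: le_trans; last first.
  by apply: lee_wpmul2l; [rewrite lee_fin|exact: (dyadic_maximal t1 mG G0 iG sF nF)].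
apply: (@le_trans _ _ (eta^-1%:E * \int[mu]_x (\sum_(Q <- F) (avg Q G `^ t * \1_(E Q) x)%:E))%E); last first.
  apply: lee_wpmul2l; first by rewrite lee_fin.
  apply: le_integral_ge0 => x.
    by apply: sume_ge0 => Q _; rewrite lee_fin mulr_ge0.
  by rewrite sumEFin lee_fin.
rewrite ge0_integral_sum; last 3 first.
- exact: measurableT.
- by move=> Q; exact: measurable_scaled_indic.
- by move=> Q x _; rewrite lee_fin mulr_ge0.
rewrite ge0_sume_distrr; last first.
  by move=> Q _; apply: integral_ge0 => x _; rewrite lee_fin mulr_ge0.
rewrite -sumEFin big_seq [leRHS]big_seq; apply: lee_sum => Q QF.
rewrite integral_scaled_indic// muleCA mulrC EFinM.
by apply: lee_wpmul2l; [rewrite lee_fin|exact: volE].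
Qed.

Lemma carleson F : (0 < n)%N -> nested [set` F] -> uniq F -> sparse eta [set` F] ->
  ((\sum_(Q <- F) vol Q * avg Q G `^ t)%:E <=
   (eta^-1 * maximal_const t)%:E * \int[mu]_x (G x `^ t)%:E)%E.
Proof.
move=> n0 nF uF spF; pose r : rel (cube R n) := fun P Q => side P <= side Q.
have sE : [set` sort r F] = [set` F] by apply/seteqP; split=> Q /=; rewrite mem_sort.
rewrite (perm_big (sort r F)) ?perm_sort//=; last by rewrite perm_sym perm_sort.
apply: carleson_sorted; rewrite ?sort_uniq ?sE//.
by apply: sort_sorted => P Q; exact: le_total.
Qed.

End carleson.
End averages.

(** * The John-Nirenberg inequality *)

Section monotone_domination.
Context d (T : measurableType d) (R : realType).
Variables (mu : {measure set T -> \bar R}) (Q A : set T) (c : R).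
Hypotheses (mQ : measurable Q) (muQ : (mu Q < +oo)%E) (mA : measurable A).

(** A monotone class argument: the bound is kept by increasing limits and, [mu Q] being finite, by
    decreasing limits of sets inside [Q]. *)
Lemma sigma_ring_domination (U : set (set T)) : setring U ->
  (forall B, U B -> [/\ measurable B, B `<=` Q & (mu (A `&` B) <= c%:E * mu B)%E]) ->
  forall B, <<sr U >> B -> measurable B /\ (mu (A `&` B) <= c%:E * mu B)%E.
Proof.
move=> rU hU B UB.
pose M := [set B | [/\ measurable B, B `<=` Q & (mu (A `&` B) <= c%:E * mu B)%E]].
suff : M B by case.
have limM (F : (set T)^nat) V : (mu \o (fun i => A `&` F i)) @ \oo --> mu (A `&` V) ->
    (mu \o F) @ \oo --> mu V -> (forall i, M (F i)) -> (mu (A `&` V) <= c%:E * mu V)%E.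
  move=> cA cV MF; have cV' : (fun i => c%:E * mu (F i))%E @ \oo --> (c%:E * mu V)%E.
    by apply: cvgeZl.
  rewrite -(cvg_lim _ cA)// -(cvg_lim _ cV')//; apply: lee_lim.
  - by apply/cvg_ex; eexists; exact: cA.
  - by apply/cvg_ex; eexists; exact: cV'.
  - by apply: nearW => i; have [] := MF i.
move: B UB; apply: monotone_setring_sub_g_sigma_ring => //.
split=> F monF MF; have mF i : measurable (F i) by have [] := MF i.
- have mU : measurable (\bigcup_i F i) by exact: bigcupT_measurable.
  split=> //; first by apply: bigcup_sub => i _; have [] := MF i.
  apply: limM MF; last exact: nondecreasing_cvg_mu.
  rewrite setI_bigcupr; apply: nondecreasing_cvg_mu.
  + by move=> i; exact: measurableI.
  + by apply: bigcupT_measurable => i; exact: measurableI.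
  + by move=> i j ij; apply/subsetPset; apply: setIS; exact/subsetPset/monF.
- have mU : measurable (\bigcap_i F i) by exact: bigcapT_measurable.
  have fin (V : set T) : measurable V -> V `<=` F 0%N -> (mu V < +oo)%E.
    move=> mV V0; apply: le_lt_trans muQ; apply: le_measure; rewrite ?inE//.
    by apply: (subset_trans V0); have [] := MF 0%N.
  split=> //; first by move=> x /(_ 0%N Logic.I); have [_ + _] := MF 0%N; exact.
  apply: limM MF; last by apply: nonincreasing_cvg_mu => //; exact: fin.
  rewrite -bigcapIr; last by exists 0%N.
  apply: nonincreasing_cvg_mu.
  + by apply: fin; [exact: measurableI|exact: subIsetr].
  + by move=> i; exact: measurableI.
  + by apply: bigcapT_measurable => i; exact: measurableI.
  + by move=> i j ij; apply/subsetPset; apply: setIS; exact/subsetPset/monF.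
Qed.

End monotone_domination.

(** * Density of sets in dyadic cubes *)

Section saturated.
Context {R : realType} {n : nat}.
Local Notation E := {ffun 'I_n -> bool}.
Local Notation mu := (@lebesgue_Rn R n).
Variable Q : cube R n.

(** These are the unions of generation-[N] descendants of [Q]. The dichotomy makes refinement and
    Boolean operations immediate, without handling lists of cubes. *)
Definition saturated N (U : set (Rn R n)) : Prop := U `<=` cube_set Q /\
  forall s, size s = N -> cube_set (offspring Q s) `<=` U \/
                          cube_set (offspring Q s) `&` U = set0.

Lemma saturated_le N M U : (N <= M)%N -> saturated N U -> saturated M U.
Proof.
move=> NM [UQ sU]; split=> // s sM; have [|sN|sN] := sU (take N s).
- by rewrite size_takel// sM.
- by left => x; rewrite -{1}(cat_take_drop N s) => /sub_offspring_cat /sN.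
- right; apply/seteqP; split => // x [].
  rewrite -{1}(cat_take_drop N s) => /sub_offspring_cat xs Ux.
  by rewrite -sN.
Qed.

Lemma saturated_offspring s : saturated (size s) (cube_set (offspring Q s)).
Proof.
split=> [|t ts]; first exact: sub_offspring.
have [->|/set0P[x [xt xs]]] := eqVneq (cube_set (offspring Q t) `&` cube_set (offspring Q s)) set0.
  by right.
by left; rewrite (offspring_meet_eq ts xt xs).
Qed.

Definition dyadic_ring : set (set (Rn R n)) := [set U | exists N, saturated N U].

Lemma setring_dyadic_ring : setring dyadic_ring.
Proof.
have common U V : dyadic_ring U -> dyadic_ring V ->
    exists N, saturated N U /\ saturated N V.
  move=> [N sU] [M sV]; exists (maxn N M); split.
    exact: saturated_le (leq_maxl _ _) sU.
  exact: saturated_le (leq_maxr _ _) sV.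
split.
- by exists 0%N; split => // s _; right; rewrite setI0.
- move=> U V /common/[apply] -[N [[UQ sU] [VQ sV]]]; exists N; split.
    by move=> x [/UQ|/VQ].
  move=> s sN; have [Us|Us] := sU s sN; first by left => x /Us; left.
  have [Vs|Vs] := sV s sN; first by left => x /Vs; right.
  by right; rewrite setIUr Us Vs setU0.
- move=> U V /common/[apply] -[N [[UQ sU] [VQ sV]]]; exists N; split.
    by move=> x [/UQ].
  move=> s sN; have [Us|Us] := sU s sN; last first.
    by right; rewrite setDE setIA Us set0I.
  have [Vs|Vs] := sV s sN.
    by right; apply/seteqP; split=> // x [/Vs Vx []].
  left => x xs; split; first exact: Us.
  by move=> Vx; have : (cube_set (offspring Q s) `&` V) x by []; rewrite Vs.
Qed.

Lemma saturatedE N U : saturated N U ->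
  U = \bigcup_(s in [set s : N.-tuple E | cube_set (offspring Q s) `<=` U])
        cube_set (offspring Q s).
Proof.
move=> [UQ sU]; apply/seteqP; split => [x Ux|x [s /= + xs]]; last exact.
have [s [sN xs]] := offspring_cover N (UQ _ Ux).
have sz : size s == N by rewrite sN.
exists (Tuple sz) => //=; have [//|sU0] := sU s sN.
by have : (cube_set (offspring Q s) `&` U) x by []; rewrite sU0.
Qed.

Lemma dyadic_ring_measurable U : dyadic_ring U -> measurable U.
Proof.
move=> [N /saturatedE ->]; apply: fin_bigcup_measurable => // s _.
exact: measurable_cube_set.
Qed.

Lemma dyadic_ring_domination (A : set (Rn R n)) (c : R) : measurable A ->
  (forall s, mu (A `&` cube_set (offspring Q s)) <= c%:E * mu (cube_set (offspring Q s)))%E ->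
  forall U, dyadic_ring U -> (mu (A `&` U) <= c%:E * mu U)%E.
Proof.
move=> mA hA U [N satU].
pose I := [set s : N.-tuple E | cube_set (offspring Q s) `<=` U].
have tI : trivIset I (fun s : N.-tuple E => cube_set (offspring Q s)).
  move=> s t _ _ [x [xs xt]]; apply: val_inj.
  by apply: offspring_meet_eq xs xt; rewrite !size_tuple.
have fI : finite_set I by exact: finite_finset.
have mc (s : N.-tuple E) : measurable (cube_set (offspring Q s)).
  exact: measurable_cube_set.
rewrite (saturatedE satU) -/I setI_bigcupr.
rewrite !measure_fin_bigcup//; last 2 first.
- move=> s t Is It [x [[_ xs] [_ xt]]]; apply: (tI s t Is It).
  by exists x.
- by move=> s _; exact: measurableI.
rewrite ge0_mule_fsumr//; apply: (lee_fsum fI) => s _; exact: hA.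
Qed.

(** The sigma-algebra of tuples is generated by the coordinates and that of the line by rays, so
    that only half spaces remain. *)
Lemma dyadic_ring_borel (B : set (n.-tuple (measurableTypeR R))) :
  measurable B -> <<sr dyadic_ring >> ((B : set (Rn R n)) `&` cube_set Q).
Proof.
have [sr0 srD srU] := smallest_sigma_ring dyadic_ring.
have srQ : <<sr dyadic_ring >> (cube_set Q).
  by apply: sub_g_sigma_ring; exists 0%N; exact: (saturated_offspring [::]).
(* As [cube_set Q] belongs to the sigma-ring, traces on it admit complements. The map [f] is the
   identity in one use and a coordinate in the other. *)
have sig (S : Type) (f : Rn R n -> S) :
    sigma_algebra setT [set Y | <<sr dyadic_ring >> (f @^-1` Y `&` cube_set Q)].
  split=> [|Y /= SY|F SF] /=.
  - by rewrite preimage_set0 set0I.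
  - rewrite setTD preimage_setC setIC -setDE.
    rewrite (_ : _ `\` _ = cube_set Q `\` (f @^-1` Y `&` cube_set Q)); first exact: srD.
    by apply/seteqP; split=> x [Qx nY]; split => //; [case|move=> Yx; apply: nY].
  - by rewrite preimage_bigcup setI_bigcupl; exact: srU.
suff h : @measurable _ (n.-tuple (measurableTypeR R)) `<=`
    [set Y | <<sr dyadic_ring >> (@idfun (Rn R n) @^-1` Y `&` cube_set Q)].
  by move=> mB; exact: (h _ mB).
apply: smallest_sub; first exact: sig.
elim/big_ind : _ => // [G H GS HS Y [/GS|/HS]//|i _ _ [Z mZ <-]].
rewrite setTI /=.
suff h : @measurable _ (measurableTypeR R) `<=`
    [set Y | <<sr dyadic_ring >> ((fun x : Rn R n => tnth x i) @^-1` Y `&` cube_set Q)].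
  exact: (h _ mZ).
rewrite RGenInftyO.measurableE; apply: smallest_sub; first exact: sig.
move=> _ [a ->] /=.
(* The half space is the union of the dyadic cubes that it contains. *)
pose H := [set x : Rn R n | tnth x i < a].
pose F k := if unpickle k is Some s then
  if `[< cube_set (offspring Q s) `<=` H >] then cube_set (offspring Q s) else set0
  else set0.
rewrite (_ : _ `&` _ = \bigcup_k F k).
  apply: srU => k; rewrite /F; case: (unpickle k) => [s|]//; case: ifPn => // _.
  by apply: sub_g_sigma_ring; exists (size s); exact: saturated_offspring.
apply/seteqP; split => x.
  move=> [/=]; rewrite in_itv/= => xa Qx.
  have [N hN] : exists N, side Q / 2 ^+ N < a - tnth x i.
    have e0 : 0 < a - tnth x i by rewrite subr_gt0.
    have q0 : 0 <= side Q / (a - tnth x i) by rewrite divr_ge0// ltW// side_gt0.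
    exists (Num.bound (side Q / (a - tnth x i))); set N := Num.bound _.
    rewrite ltr_pdivrMr ?exprn_gt0// mulrC -ltr_pdivrMr//.
    apply: (lt_trans (archi_boundP q0)); rewrite -natrX ltr_nat.
    exact: ltn_expl.
  have [s [sN xs]] := offspring_cover N Qx.
  exists (pickle s) => //; rewrite /F pickleK.
  case: asboolP => // nsub; exfalso; apply: nsub => y ys.
  have /andP[_ hy] := ys i; have /andP[hx _] := xs i.
  by move: hN hy; rewrite /H/= -sN -side_offspring; lra.
move=> [k _]; rewrite /F; case: (unpickle k) => [s|]//; case: asboolP => // sH xs.
by split; [rewrite /= in_itv/=; exact: sH|exact: sub_offspring xs].
Qed.

(** If [A] fills at most the proportion [c] of every descendant, the same bound holds for every
    Borel set containing [A]. Passing to the infimum over Borel covers gives [mu A <= c * mu A] with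
    [c < 1]. *)
Lemma density (A : set (Rn R n)) (c : R) : 0 < c -> c < 1 -> measurable A ->
  A `<=` cube_set Q ->
  (forall s, mu (A `&` cube_set (offspring Q s)) <= c%:E * mu (cube_set (offspring Q s)))%E ->
  mu A = 0.
Proof.
move=> c0 c1 mA AQ hA.
have mQ := measurable_cube_set Q.
have fQ : (mu (cube_set Q) < +oo)%E by rewrite lebesgue_cube ltry.
have dom (B : set (n.-tuple (measurableTypeR R))) : measurable B -> A `<=` B ->
    (mu A <= c%:E * mu B)%E.
  move=> mB AB; have := dyadic_ring_borel mB.
  move=> /(sigma_ring_domination mQ fQ mA setring_dyadic_ring).
  move=> /(_ c) [].
    move=> U rU; split; first exact: dyadic_ring_measurable.
      by case: rU => N [].
    exact: dyadic_ring_domination.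
  move=> mBQ; rewrite setIA (setIidl AB) (setIidl AQ) => /le_trans; apply.
  apply: lee_wpmul2l; first by rewrite lee_fin ltW.
  apply: le_measure; rewrite ?inE//; first exact: measurable_Rn_of_tuple.
have fA : mu A \is a fin_num.
  rewrite ge0_fin_numE//; apply: le_lt_trans fQ; apply: le_measure; rewrite ?inE//.
(* The measure on the right is an infimum over countable Borel covers; [c^-1 * mu A] is a lower
   bound for each of them. *)
have : (c^-1%:E * mu A <= mu A)%E.
  apply: le_ereal_inf_tmp => _ [F [mF AF] <-].
  rewrite lee_pdivrMl//; apply: le_trans (dom _ _ AF) _.
    exact: bigcupT_measurable.
  apply: lee_wpmul2l; first by rewrite lee_fin ltW.
  rewrite /lebesgue_Rn /completed_measure_extension measurable_mu_extE; last first.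
    exact: bigcupT_measurable.
  apply: measure_sigma_subadditive => //; exact: bigcupT_measurable.
have : (0 <= mu A)%E by [].
rewrite -(fineK fA) -EFinM !lee_fin => a0 ca; congr EFin.
apply/eqP; rewrite eq_le a0 andbT.
have : 1 < c^-1 by rewrite invf_gt1.
by nra.
Qed.

End saturated.

Section deviation.
Context d (T : measurableType d) (R : realType).
Variable mu : {measure set T -> \bar R}.

Lemma cst_le_integral (A D : set T) (f : T -> R) (c : R) : measurable A -> measurable D ->
  A `<=` D -> measurable_fun D f -> (forall x, D x -> 0 <= f x) -> 0 <= c ->
  (forall x, A x -> c <= f x) -> (c%:E * mu A <= \int[mu]_(x in D) (f x)%:E)%E.
Proof.
move=> mA mD AD mf f0 c0 cf; rewrite -integral_cst//.
have mE : measurable_fun D (EFin \o f) by exact/measurable_EFinP.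
apply: (@le_trans _ _ (\int[mu]_(x in A) (f x)%:E)%E).
  apply: ge0_le_integral => //; first exact: measurable_funS mE.
by apply: ge0_subset_integral.
Qed.

Lemma integrable_dev (D : set T) (f : T -> R) (c : R) : measurable D ->
  (mu D < +oo)%E -> mu.-integrable D (EFin \o f) ->
  mu.-integrable D (EFin \o (fun x => f x - c)).
Proof.
move=> mD fD iF.
have ic : mu.-integrable D (EFin \o cst c).
  apply: measurable_bounded_integrable => //.
  exact: bounded_cst.
rewrite (_ : EFin \o _ = (EFin \o f) \- (EFin \o cst c))%E; last first.
  by apply/funext => x /=; rewrite EFinB.
exact: integrableB.
Qed.

Lemma integrable_absdev (D : set T) (f : T -> R) (c : R) : measurable D ->
  (mu D < +oo)%E -> mu.-integrable D (EFin \o f) ->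
  mu.-integrable D (EFin \o (fun x => `|f x - c|)).
Proof.
move=> mD fD iF; have := integrable_abse (integrable_dev c mD fD iF).
by congr (mu.-integrable D _); apply/funext => x /=.
Qed.

End deviation.

(** * Stopping cubes and the decay of level sets *)

Section john_nirenberg.
Context {R : realType} {n : nat}.
Local Notation E := {ffun 'I_n -> bool}.
Local Notation mu := (@lebesgue_Rn R n).
Hypothesis n_gt0 : (0 < n)%N.
Variables (b : Rn R n -> R) (B : R).
Hypothesis mb : measurable_fun setT b.
Hypothesis ib : forall Q, mu.-integrable (cube_set Q) (EFin \o b).
Hypothesis B_gt0 : 0 < B.
Hypothesis osc : forall Q, avg Q (fun x => `|b x - avg Q b|) <= B.

Let fcube Q : ((mu : {measure set (Rn R n) -> \bar R}) (cube_set Q) < +oo)%E.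
Proof. by rewrite measure_cube ltry. Qed.

Let mdev c : measurable_fun setT (fun x => `|b x - c|).
Proof.
apply: measurableT_comp; first exact: normr_measurable.
by apply: measurable_funB; [exact: mb|exact: measurable_cst].
Qed.

Let idev Q c : mu.-integrable (cube_set Q) (EFin \o (fun x => `|b x - c|)).
Proof.
by apply: integrable_absdev; [exact: measurable_cube_set|exact: fcube|exact: ib].
Qed.

Lemma avg_dev P c : `|avg P b - c| <= avg P (fun x => `|b x - c|).
Proof.
have v0 := vol_gt0 P.
have -> : avg P b - c = (vol P)^-1 * \int[mu]_(x in cube_set P) (b x - c).
  rewrite RintegralB; [|exact: measurable_cube_set|exact: ib|]; last first.
    apply: measurable_bounded_integrable; [exact: measurable_cube_set|exact: fcube| |exact: bounded_cst].
    exact: measurable_cst.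
  rewrite Rintegral_cst; last exact: measurable_cube_set.
  by rewrite /avg fine_lebesgue_cube mulrBr mulrCA mulVf ?mulr1// gt_eqF.
rewrite normrM ger0_norm ?invr_ge0 ?(ltW v0)// /avg fine_lebesgue_cube.
rewrite ler_wpM2l ?invr_ge0 ?(ltW v0)//.
apply: le_normr_Rintegral; first exact: measurable_cube_set.
by apply: integrable_dev; [exact: measurable_cube_set|exact: fcube|exact: ib].
Qed.

(** The parent of a stopped cube has average at most [2 * B], and passing to a child costs a factor
    [2^n]. The product [jn_const * B] is also the height of one level. *)
Definition jn_const : R := 2 ^+ n.+1.

Lemma jn_const_ge4 : 4 <= jn_const.
Proof.
rewrite /jn_const; apply: (@le_trans _ _ (2 ^+ 2)); first by rewrite expr2; lra.
by rewrite ler_weXn2l// ler1n.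
Qed.

Let c_gt0 : 0 < jn_const. Proof. by rewrite exprn_gt0. Qed.

Section stopping.
Variable Q : cube R n.
Let phi x := `|b x - avg Q b|.

Definition bad (s : seq E) : Prop := 2 * B < avg (offspring Q s) phi.

(** The Calderon-Zygmund cubes: bad words none of whose proper prefixes is bad are the maximal bad
    cubes. *)
Definition stops (s : seq E) : Prop :=
  bad s /\ forall t u, s = t ++ u -> u != [::] -> ~ bad t.

Lemma bad_stops s : bad s -> exists t u, s = t ++ u /\ stops t.
Proof.
move=> bs; pose P k := `[< bad (take k s) >].
have exP : exists k, P k by exists (size s); apply/asboolP; rewrite take_size.
exists (take (ex_minn exP) s), (drop (ex_minn exP) s); rewrite cat_take_drop; split=> //.
case: ex_minnP => k /asboolP bk kmin; split=> // t u tuE u0 bt.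
have : (k <= size t)%N.
  apply: kmin; apply/asboolP.
  have -> // : take (size t) s = t.
  by rewrite -(cat_take_drop k s) tuE -catA take_size_cat.
have : (size t + size u <= k)%N.
  by rewrite -size_cat -tuE size_take; case: ltnP => // /ltnW.
case: u u0 {tuE} => //= e u _ h1 h2.
by have := leq_trans h1 h2; rewrite addnS -[X in (_ < X)%N]addn0 ltn_add2l.
Qed.

Lemma stops_meet s t x : stops s -> stops t -> cube_set (offspring Q s) x ->
  cube_set (offspring Q t) x -> s = t.
Proof.
wlog st : s t / (size s <= size t)%N.
  move=> W Ss St xs xt; have [|/ltnW] := leqP (size s) (size t); first by move=> /W; exact.
  by move=> /W /(_ St Ss xt xs).
move=> [bs _] [_ St] xs xt; have [u tE] := offspring_meet st xs xt.
have [u0|/(St _ _ tE)//] := eqVneq u [::].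
by rewrite tE u0 cats0.
Qed.

Lemma stops_avg s : stops s -> avg (offspring Q s) phi <= jn_const * B.
Proof.
(* The root is not bad, its average being at most [B]; hence a stopped cube has a parent, and that
   parent is not bad. *)
case: (lastP s) => [[]|t e [_ St]].
  move=> h; have h2 : 2 * B < B by exact: lt_le_trans h (osc Q).
  have := B_gt0; lra.
have {}St : ~ bad t by apply: (St t [:: e]) => //; rewrite cats1.
set P := offspring Q t; have -> : offspring Q (rcons t e) = child P e.
  by rewrite /offspring foldl_rcons.
have : (\int[mu]_(x in cube_set (child P e)) (phi x)%:E <=
        \int[mu]_(x in cube_set P) (phi x)%:E)%E.
  apply: ge0_subset_integral.
  - exact: measurable_cube_set.
  - exact: measurable_cube_set.
  - by apply/measurable_EFinP; apply: measurable_funTS; exact: mdev.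
  - by move=> x _; rewrite lee_fin; exact: normr_ge0.
  - exact: sub_child.
rewrite !avg_integral; [|exact: idev..].
have v0 := vol_gt0 P; have vE : vol (child P e) = vol P / 2 ^+ n.
  by rewrite /vol side_child expr_div_n.
rewrite vE lee_fin mulrAC ler_pdivrMr ?exprn_gt0// -mulrA ler_pM2l// => h.
have p0 : 0 < 2 ^+ n :> R by rewrite exprn_gt0.
have : avg P phi <= 2 * B by rewrite leNgt; apply/negP.
move=> h2; apply: (le_trans h); rewrite /jn_const exprS.
have := ler_wpM2r (ltW p0) h2; lra.
Qed.

(** Recentring at the mean over a stopped cube costs at most one level, which is what the induction
    on levels consumes. *)
Lemma stops_shift s x : stops s ->
  phi x <= `|b x - avg (offspring Q s) b| + jn_const * B.
Proof.
move=> Ss; have h := le_trans (avg_dev (offspring Q s) (avg Q b)) (stops_avg Ss).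
rewrite /phi -[X in `|X|](subrKA (avg (offspring Q s) b)).
by apply: (le_trans (ler_normD _ _)); rewrite lerD2l.
Qed.

(* By density, [phi] stays below the threshold outside the stopped cubes. *)
Lemma outside_stops_negligible (A := [set x | [/\ cube_set Q x, jn_const * B < phi x &
    forall s, stops s -> ~ cube_set (offspring Q s) x]]) :
  measurable A /\ mu A = 0.
Proof.
have mphi : measurable_fun setT phi by exact: mdev.
have mlev : measurable [set x | jn_const * B < phi x].
  rewrite -[X in measurable X]setTI.
  have := mphi measurableT _ (measurable_itv `]jn_const * B, +oo[).
  by congr measurable; apply/seteqP; split => x /=; rewrite in_itv/= andbT.
pose F k : set (Rn R n) := if unpickle k is Some s then
  if `[< stops s >] then cube_set (offspring Q s) else set0 else set0.
have mU : measurable (\bigcup_k F k).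
  apply: bigcupT_measurable => k; rewrite /F; case: (unpickle k) => [s|]//.
  by case: ifPn => // _; exact: measurable_cube_set.
have mA : measurable A.
  have -> : A = (cube_set Q `&` [set x | jn_const * B < phi x]) `\` \bigcup_k F k.
    apply/seteqP; split=> [x [Qx xphi ns]|x [[Qx xphi] nU]].
      split=> //; move=> [k _]; rewrite /F; case: (unpickle k) => [s|]//.
      by case: asboolP => // /ns.
    split=> // s Ss xs; apply: nU; exists (pickle s) => //.
    by rewrite /F pickleK asboolT.
  by apply: measurableD; [apply: measurableI; [exact: measurable_cube_set|]|].
split => //; have c4 := jn_const_ge4.
(* On a cube that is not bad, Chebyshev's inequality gives the proportion [2 * B / (jn_const * B)],
   at most [1/2]. *)
apply: (@density _ _ Q A (2 / jn_const)) => //.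
- by rewrite divr_gt0.
- by rewrite ltr_pdivrMr//; lra.
- by move=> x [].
move=> s; have mcs := measurable_cube_set (offspring Q s).
(* A bad word has a stopped prefix, whose cube [A] avoids. *)
have [bs|nbs] := pselect (bad s).
  have -> : A `&` cube_set (offspring Q s) = set0.
    apply/seteqP; split=> // x [[_ _ ns] xs]; have [t [u [su St]]] := bad_stops bs.
    by apply: (ns t St); move: xs; rewrite su; exact: sub_offspring_cat.
  rewrite measure0 mule_ge0// lee_fin divr_ge0// ltW//.
have h : ((jn_const * B)%:E * mu (A `&` cube_set (offspring Q s)) <=
    \int[mu]_(x in cube_set (offspring Q s)) (phi x)%:E)%E.
  apply: cst_le_integral.
  - exact: measurableI.
  - exact: mcs.
  - exact: subIsetr.
  - exact: measurable_funTS.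
  - by move=> x _; exact: normr_ge0.
  - by rewrite mulr_ge0// ltW.
  - by move=> x [[_ /ltW ? _] _].
move: h; rewrite avg_integral; last exact: idev.
have fin : mu (A `&` cube_set (offspring Q s)) \is a fin_num.
  rewrite ge0_fin_numE//; apply: le_lt_trans (fcube (offspring Q s)).
  by apply: le_measure; rewrite ?inE//; exact: measurableI.
rewrite lebesgue_cube -(fineK fin) -!EFinM !lee_fin => h.
have a2 : avg (offspring Q s) phi <= 2 * B by rewrite leNgt; apply/negP.
rewrite mulrAC ler_pdivlMr// -(ler_pM2r B_gt0).
have v0 := vol_gt0 (offspring Q s).
have := ler_wpM2l (ltW v0) a2; lra.
Qed.

End stopping.

Definition level Q (k : nat) : set (Rn R n) :=
  [set x | cube_set Q x /\ k%:R * (jn_const * B) < `|b x - avg Q b|].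

Lemma measurable_level Q k : measurable (level Q k).
Proof.
have := mdev (avg Q b) measurableT (measurable_itv `]k%:R * (jn_const * B), +oo[).
rewrite setTI => h; have := measurableI _ _ (measurable_cube_set Q) h.
by congr measurable; apply/seteqP; split => x [Qx /=]; rewrite in_itv/= andbT.
Qed.

(** Induction on [k], for all cubes at once. Up to a null set, level [k + 1] of [Q] lies in the
    levels [k] of the stopped cubes. These cubes are disjoint and fill at most half of [Q], since
    the deviation averages more than [2 * B] on each of them and at most [B] on [Q]. *)
Lemma level_le Q k : (mu (level Q k) <= (2^-1 ^+ k * vol Q)%:E)%E.
Proof.
elim: k Q => [|k ih] Q.
  rewrite expr0 mul1r -lebesgue_cube; apply: le_measure; rewrite ?inE.
  - exact: measurable_level.
  - exact: measurable_cube_set.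
  - by move=> x [].
pose phi x := `|b x - avg Q b|.
(* With [pickle_inv] each word has exactly one index, so the sets [F j] are disjoint. *)
pose F j := if pickle_inv j is Some s then
  if `[< stops Q s >] then cube_set (offspring Q s) else set0 else set0.
pose G j := if pickle_inv j is Some s then
  if `[< stops Q s >] then level (offspring Q s) k else set0 else set0.
set Z := [set x | [/\ cube_set Q x, jn_const * B < phi x &
               forall s, stops Q s -> ~ cube_set (offspring Q s) x]].
have sub : level Q k.+1 `<=` Z `|` \bigcup_j G j.
  move=> x [Qx xk]; have [[s [Ss xs]]|ns] := pselect (exists s, stops Q s /\ cube_set (offspring Q s) x).
    right; exists (pickle s) => //; rewrite /G pickleK_inv asboolT//; split=> //.
    have := stops_shift x Ss; move: xk; rewrite -natr1 mulrDl mul1r.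
    lra.
  left; split=> //; last by move=> s Ss xs; apply: ns; exists s.
  apply: le_lt_trans xk; rewrite ler_peMl//; first by rewrite mulr_ge0// ltW.
  by rewrite ler1n.
have [mZ Z0] := outside_stops_negligible Q; rewrite -/Z in mZ Z0.
have mF j : measurable (F j).
  rewrite /F; case: (pickle_inv j) => [s|]//; case: ifPn => // _.
  exact: measurable_cube_set.
have mG j : measurable (G j).
  rewrite /G; case: (pickle_inv j) => [s|]//; case: ifPn => // _.
  exact: measurable_level.
have mUG : measurable (\bigcup_j G j) by exact: bigcupT_measurable.
have tF : trivIset setT F.
  move=> i j _ _ [x []]; rewrite /F.
  case Ei : (pickle_inv i) => [s|]//; case: asboolP => // Ss xs.
  case Ej : (pickle_inv j) => [t|]//; case: asboolP => // St xt.
  have st := stops_meet Ss St xs xt.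
  by rewrite -[i](pickle_invK (T := seq E)) -[j](pickle_invK (T := seq E)) Ei Ej /= st.
have mphi D : measurable_fun D (EFin \o phi).
  by apply/measurable_EFinP; apply: measurable_funTS; exact: mdev.
have phi0 x : (0 <= (phi x)%:E)%E by rewrite lee_fin normr_ge0.
have B2 : 0 < 2 * B by rewrite mulr_gt0.
(* On a stopped cube the volume is at most the integral of [phi] divided by [2 * B]; the remaining
   [2^-k] is the induction hypothesis. *)
pose a : R := 2^-1 ^+ k / (2 * B).
have a0 : 0 <= a by rewrite divr_ge0 ?exprn_ge0 ?invr_ge0 ?(ltW B2).
have GF j : (mu (G j) <= a%:E * \int[mu]_(x in F j) (phi x)%:E)%E.
  rewrite /G /F; case: (pickle_inv j) => [s|]; last by rewrite measure0 integral_set0 mule0.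
  case: asboolP => Ss; last by rewrite measure0 integral_set0 mule0.
  apply: (le_trans (ih _)); rewrite avg_integral; last exact: idev.
  have [bs _] := Ss; rewrite -EFinM lee_fin /a -!mulrA ler_wpM2l ?exprn_ge0 ?invr_ge0//.
  rewrite mulrC ler_pdivlMr// ler_wpM2l ?(ltW (vol_gt0 _))//; exact: ltW.
have : (mu (level Q k.+1) <= mu Z + \sum_(j <oo) mu (G j))%E.
  apply: (@le_trans _ _ (mu (Z `|` \bigcup_j G j))).
    by apply: le_measure => //; rewrite ?inE; [exact: measurable_level|exact: measurableU].
  apply: (le_trans (measureU2 _ mZ mUG)); apply: leeD2l.
  exact: measure_sigma_subadditive.
move=> /le_trans; apply; rewrite Z0 add0e.
apply: (@le_trans _ _ (\sum_(j <oo) (a%:E * \int[mu]_(x in F j) (phi x)%:E))%E).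
  by apply: lee_nneseries => // j _ _; exact: measure_ge0.
rewrite nneseriesZl; last by move=> j _; apply: integral_ge0.
rewrite -ge0_integral_bigcup//.
apply: (@le_trans _ _ (a%:E * \int[mu]_(x in cube_set Q) (phi x)%:E)%E).
  apply: lee_wpmul2l; first by rewrite lee_fin.
  apply: ge0_subset_integral.
  - exact: bigcupT_measurable.
  - exact: measurable_cube_set.
  - exact: mphi.
  - by move=> x _; exact: phi0.
  - apply: bigcup_sub => j _; rewrite /F; case: (pickle_inv j) => [s|]; last exact: sub0set.
    by case: asboolP => _; [exact: sub_offspring|exact: sub0set].
rewrite avg_integral; last exact: idev.
rewrite -EFinM lee_fin.
have -> : 2^-1 ^+ k.+1 * vol Q = a * (vol Q * B).
  by rewrite /a exprSr; field; rewrite gt_eqF// ?B_gt0.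
rewrite ler_wpM2l// ler_wpM2l ?(ltW (vol_gt0 _))//; exact: osc.
Qed.

End john_nirenberg.

(** * From the decay of level sets to moments of the oscillation *)

Section moment_series.
Context {R : realType}.

(** Any ratio strictly between [1] and [2] would serve in place of [3/2]: [k^r] is bounded by a
    multiple of [(3/2)^k], which against [2^-k] leaves a geometric series of ratio [3/4]. The [6] of
    [moment_const] is [(3/2) / (1 - 3/4)]. *)
Definition moment_gap (r : R) : R := (3 / 2) `^ r^-1 - 1.
Definition moment_const (r : R) : R := 6 * (moment_gap r) `^ (- r).

Lemma moment_gap_gt0 r : 0 < r -> 0 < moment_gap r.
Proof.
move=> r0; rewrite subr_gt0 -[X in X < _](powRr0 (3 / 2)).
rewrite /powR gt_eqF ?divr_gt0// ltr_expR ltr_pM2r ?invr_gt0//.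
by apply: ln_gt0; lra.
Qed.

Lemma moment_const_gt0 r : 0 < r -> 0 < moment_const r.
Proof. by move=> r0; rewrite mulr_gt0// powR_gt0// moment_gap_gt0. Qed.

(* Bernoulli's inequality for the [k]-th power of [(3/2)^(1/r)]. *)
Lemma powR_nat_le (r : R) (k : nat) : 0 < r ->
  k%:R `^ r <= (moment_gap r) `^ (- r) * (3 / 2) ^+ k.
Proof.
move=> r0; have g0 := moment_gap_gt0 r0.
have bern : k%:R * moment_gap r <= (1 + moment_gap r) ^+ k.
  elim: k => [|k ih]; first by rewrite mul0r expr0.
  have h1 : 1 <= (1 + moment_gap r) ^+ k by rewrite exprn_ege1// lerDl ltW.
  rewrite exprS mulrDl mul1r -natr1 mulrDl mul1r lerD// ler_peMr// ltW//.
have {}bern : (k%:R * moment_gap r) `^ r <= (3 / 2) ^+ k.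
  have -> : (3 / 2) ^+ k = ((1 + moment_gap r) ^+ k) `^ r :> R.
    rewrite subrKC -powR_mulrn ?powR_ge0// -!powRrM mulrCA mulVf ?gt_eqF// mulr1.
    by rewrite powR_mulrn// divr_ge0.
  rewrite ge0_ler_powR// ?nnegrE ?(ltW r0)//.
  - by rewrite mulr_ge0// ltW.
  - by rewrite exprn_ge0// addr_ge0// ltW.
rewrite powRM// ?(ltW g0)// in bern.
by rewrite powRN -ler_pdivrMl ?invr_gt0 ?powR_gt0// invrK mulrC.
Qed.

Lemma moment_series_le (r : R) : 0 < r ->
  (\sum_(k <oo) (k.+1%:R `^ r * 2^-1 ^+ k)%:E <= (moment_const r)%:E)%E.
Proof.
move=> r0; set g := (moment_gap r) `^ (- r).
have g0 : 0 < g by rewrite powR_gt0// moment_gap_gt0.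
apply: (@le_trans _ _ (\sum_(k <oo) (geometric (3 / 2 * g) (3 / 4) k)%:E)%E).
  apply: lee_nneseries => [k _ _|k _].
    by rewrite lee_fin mulr_ge0 ?powR_ge0// exprn_ge0// invr_ge0.
  rewrite lee_fin /=; apply: (le_trans (ler_wpM2r _ (powR_nat_le k.+1 r0))).
    by rewrite exprn_ge0// invr_ge0.
  rewrite -/g exprS.
  have -> : (3 / 4 : R) ^+ k = (3 / 2) ^+ k * 2^-1 ^+ k.
    by rewrite -exprMn; congr (_ ^+ _); field.
  by rewrite le_eqVlt; apply/orP; left; apply/eqP; ring.
have ge0 k : (0 <= (geometric (3 / 2 * g) (3 / 4) k)%:E)%E.
  by rewrite lee_fin geometric_ge0// ?mulr_ge0 ?(ltW g0)// divr_ge0.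
apply: lime_le; first by apply: is_cvg_nneseries => k _ _; exact: ge0.
apply: nearW => N; rewrite sumEFin lee_fin.
have := @geometric_le_lim R N (3 / 2 * g) (3 / 4).
rewrite /series /= => /(_ _)/(_ _)/(_ _)/le_trans; apply.
- by rewrite mulr_ge0 ?(ltW g0)// divr_ge0.
- by rewrite divr_gt0.
- by rewrite ger0_norm//; lra.
- rewrite /moment_const -/g (_ : 1 - 3 / 4 = 4^-1 :> R); last by field.
  by rewrite invrK; lra.
Qed.

End moment_series.

Section layer_sum.
Context d (T : measurableType d) (R : realType).
Variable mu : {measure set T -> \bar R}.

(** A discrete layer cake: where [k * h < phi x <= (k + 1) * h], the term of index [k] alone
    dominates [phi x ^ r]. *)
Lemma layer_sum_le (D : set T) (phi : T -> R) (h r : R) (m : nat -> R) (L : nat -> set T) :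
  0 < h -> 0 < r -> measurable D -> measurable_fun D phi -> (forall x, 0 <= phi x) ->
  (forall k, L k = [set x | D x /\ k%:R * h < phi x]) ->
  (forall k, measurable (L k)) -> (forall k, mu (L k) <= (m k)%:E)%E ->
  (\int[mu]_(x in D) (phi x `^ r)%:E <=
    \sum_(k <oo) ((k.+1%:R * h) `^ r * m k)%:E)%E.
Proof.
move=> h0 r0 mD mphi phi0 LE mL Lm.
have w0 k : 0 <= (k.+1%:R * h) `^ r by exact: powR_ge0.
have mI k : measurable_fun D (fun x => ((k.+1%:R * h) `^ r * \1_(L k) x)%:E).
  exact: measurable_scaled_indic.
have I0 k x : (0 <= ((k.+1%:R * h) `^ r * \1_(L k) x)%:E)%E.
  by rewrite lee_fin mulr_ge0.
apply: (@le_trans _ _ (\int[mu]_(x in D) \sum_(k <oo) ((k.+1%:R * h) `^ r * \1_(L k) x)%:E)%E).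
  apply: ge0_le_integral; first exact: mD.
  - by move=> x _; rewrite lee_fin powR_ge0.
  - by apply/measurable_EFinP; exact: (measurableT_comp (measurable_powR _)).
  - by apply: ge0_emeasurable_sum => //.
  move=> x Dx; have [phix|] := eqVneq (phi x) 0.
    by rewrite phix powR0 ?gt_eqF//; apply: nneseries_ge0.
  move=> phix; have {}phix : 0 < phi x by rewrite lt_neqAle eq_sym phix phi0.
  have exk : exists k, phi x <= k%:R * h.
    exists (Num.bound (phi x / h)); rewrite -ler_pdivrMr// ltW//.
    by apply: archi_boundP; rewrite divr_ge0// ltW.
  case: (ex_minnP exk) => -[|k] hk kmin.
    by move: hk; rewrite mul0r leNgt phix.
  have Lkx : L k x.
    rewrite LE; split => //; rewrite ltNge; apply/negP => /kmin.
    by rewrite ltnn.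
  apply: (@le_trans _ _ ((k.+1%:R * h) `^ r * \1_(L k) x)%:E).
    rewrite indicE mem_set// mulr1 lee_fin ge0_ler_powR// ?nnegrE ?(ltW r0)//.
    by rewrite mulr_ge0// ltW.
  apply: (le_trans _ (nneseries_lim_ge k.+1 _)) => //.
  rewrite big_nat_recr//= leeDr// sume_ge0//.
rewrite integral_nneseries//; apply: lee_nneseries => [k _ _|k _].
  by apply: integral_ge0 => x _.
rewrite integral_scaled_indic// ?EFinM; last by rewrite LE => x [].
by apply: lee_wpmul2l; [rewrite lee_fin|exact: Lm].
Qed.

End layer_sum.

Section bmo.
Context {R : realType} {n : nat}.
Local Notation mu := (@lebesgue_Rn R n).

Lemma locally_integrable_cube (f : Rn R n -> R) Q : locally_integrable_Rn f ->
  mu.-integrable (cube_set Q) (EFin \o f).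
Proof.
move=> [mf lf]; have mQ := measurable_cube_set Q.
apply/integrableP; split.
  by apply/measurable_EFinP; exact: measurable_funTS.
have [K [mK cK QK]] := cube_sub_compact Q.
apply: le_lt_trans (lf K cK); apply: ge0_subset_integral; [exact: mQ|exact: mK| |by []|exact: QK].
by apply/measurable_EFinP; apply: measurable_funTS; exact: measurableT_comp.
Qed.

Definition bmo_moment_const (r : R) : R :=
  jn_const (R := R) (n := n) * (moment_const r) `^ r^-1.

Lemma bmo_moment_const_gt0 r : 0 < r -> 0 < bmo_moment_const r.
Proof. by move=> r0; rewrite mulr_gt0 ?exprn_gt0// powR_gt0// moment_const_gt0. Qed.

Lemma avg_moment_le (b : Rn R n -> R) (B r : R) Q : (0 < n)%N -> 0 < r -> 0 < B ->
  locally_integrable_Rn b ->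
  (forall Q, avg Q (fun x => `|b x - avg Q b|) <= B) ->
  (\int[mu]_(x in cube_set Q) (`|b x - avg Q b| `^ r)%:E <=
   (vol Q * (bmo_moment_const r * B) `^ r)%:E)%E.
Proof.
move=> n0 r0 B0 lb osc; have mb := lb.1.
have ib P := locally_integrable_cube P lb.
have h0 : 0 < jn_const (R := R) (n := n) * B by rewrite mulr_gt0// exprn_gt0.
have mphi : measurable_fun setT (fun x => `|b x - avg Q b|).
  apply: measurableT_comp; first exact: normr_measurable.
  by apply: measurable_funB; [exact: mb|exact: measurable_cst].
have := @layer_sum_le _ _ R (mu : {measure set _ -> \bar R}) (cube_set Q)
  (fun x => `|b x - avg Q b|) _ r (fun k => 2^-1 ^+ k * vol Q) (level b B Q) h0 r0
  (measurable_cube_set Q) (measurable_funTS mphi) (fun=> normr_ge0 _) (fun=> erefl).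
move=> /(_ _ _)/le_trans; apply => [k|k|]; [exact: measurable_level|exact: level_le|].
set h := jn_const * B in h0 *.
apply: (@le_trans _ _ (\sum_(k <oo) ((h `^ r * vol Q)%:E * (k.+1%:R `^ r * 2^-1 ^+ k)%:E))%E).
  apply: lee_nneseries => [k _ _|k _].
    by rewrite lee_fin mulr_ge0 ?powR_ge0// mulr_ge0 ?(ltW (vol_gt0 _))// exprn_ge0// invr_ge0.
  rewrite -EFinM lee_fin powRM ?(ltW h0)//.
  by rewrite le_eqVlt; apply/orP; left; apply/eqP; ring.
rewrite nneseriesZl; last first.
  by move=> k _; rewrite lee_fin mulr_ge0 ?powR_ge0// exprn_ge0// invr_ge0.
apply: (le_trans (lee_wpmul2l _ (moment_series_le r0))).
  by rewrite lee_fin mulr_ge0 ?powR_ge0// ltW// vol_gt0.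
rewrite -EFinM lee_fin.
have -> : bmo_moment_const r * B = h * (moment_const r) `^ r^-1 by rewrite /h mulrAC.
rewrite [in leRHS]powRM ?powR_ge0 ?(ltW h0)// -powRrM mulVf ?gt_eqF// powRr1 ?(ltW (moment_const_gt0 r0))//.
by rewrite le_eqVlt; apply/orP; left; apply/eqP; ring.
Qed.

Lemma bmo_normP (b : Rn R n -> R) : BMO b -> exists beta : R,
  [/\ bmo_norm b = beta%:E, 0 <= beta &
      forall Q, avg Q (fun x => `|b x - avg Q b|) <= beta].
Proof.
move=> [lb bfin].
have ub Q : ((avg Q (fun x => `|b x - avg Q b|))%:E <= bmo_norm b)%E.
  by apply: ereal_sup_ubound; exists Q.
have b0 : (0 <= bmo_norm b)%E.
  apply: le_trans (ub unit_cube); rewrite lee_fin; apply: avg_ge0 => x _.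
  exact: normr_ge0.
have bf : bmo_norm b \is a fin_num by rewrite ge0_fin_numE.
exists (fine (bmo_norm b)); split.
- by rewrite fineK.
- exact: fine_ge0.
- by move=> Q; rewrite -lee_fin fineK.
Qed.

(** A vanishing norm is reached as a limit, since [avg_moment_le] asks for a positive bound. *)
Lemma bmo_moment (b : Rn R n -> R) (beta r : R) Q : (0 < n)%N -> 0 < r ->
  BMO b -> bmo_norm b = beta%:E ->
  (\int[mu]_(x in cube_set Q) (`|b x - avg Q b| `^ r)%:E <=
   (vol Q * (bmo_moment_const r * beta) `^ r)%:E)%E.
Proof.
move=> n0 r0 Bb bE; have [beta' []] := bmo_normP Bb.
rewrite bE => -[<-] beta0 osc.
have K0 := bmo_moment_const_gt0 r0; have v0 := vol_gt0 Q.
move: beta0; rewrite le_eqVlt => /predU1P[beta0|beta0]; last first.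
  exact: avg_moment_le Bb.1 osc.
rewrite -beta0 mulr0 powR0 ?gt_eqF// mulr0.
apply/lee_addgt0Pr => e e0; rewrite add0e.
(* Chosen so that the moment bound equals [e] exactly. *)
pose B := (e / vol Q) `^ r^-1 / bmo_moment_const r.
have ev : 0 < e / vol Q by rewrite divr_gt0.
have B0 : 0 < B by rewrite divr_gt0// powR_gt0.
have := avg_moment_le Q n0 r0 B0 Bb.1.
have -> : vol Q * (bmo_moment_const r * B) `^ r = e.
  rewrite /B mulrCA mulfV ?gt_eqF// mulr1 -powRrM mulVf ?gt_eqF// powRr1 ?(ltW ev)//.
  by rewrite mulrC divfK// gt_eqF.
by apply=> P; apply: (le_trans (osc P)); rewrite -beta0 ltW.
Qed.

End bmo.

(** * The weighted and multilinear estimates *)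

Lemma ge0_bounded_integrable d (T : measurableType d) (R : realType)
    (mu : {measure set T -> \bar R}) (D : set T) (f : T -> R) (K : R) :
  measurable D -> (mu D < +oo)%E -> measurable_fun D f ->
  (forall x, 0 <= f x <= K) -> mu.-integrable D (EFin \o f).
Proof.
move=> mD fD mf fK; apply: measurable_bounded_integrable => //.
exists K; split; first exact: num_real.
move=> y Ky x _ /=; have /andP[f0 fxK] := fK x.
by rewrite ger0_norm// (le_trans fxK)// ltW.
Qed.

Section weighted.
Context {R : realType} {n : nat}.
Local Notation mu := (@lebesgue_Rn R n).
Implicit Types (Q : cube R n) (f g w b h : Rn R n -> R).

Lemma weight_integral w Q : is_weight w ->
  (\int[mu]_(x in cube_set Q) (w x)%:E = (vol Q * avg Q w)%:E)%E.
Proof. by move=> [_ lw]; apply: avg_integral; exact: locally_integrable_cube. Qed.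

Lemma avg_weight_ge0 w Q : is_weight w -> 0 <= avg Q w.
Proof. by move=> [w0 _]; apply: avg_ge0 => x _. Qed.

(** An inequality because [avg] takes a real-valued integral, which is [0] when the integral is
    infinite. *)
Lemma vol_avg_le_integral Q f : (forall x, 0 <= f x) ->
  ((vol Q * avg Q f)%:E <= \int[mu]_(x in cube_set Q) (f x)%:E)%E.
Proof.
move=> f0; rewrite /avg fine_lebesgue_cube mulVKf ?gt_eqF ?vol_gt0//.
rewrite /Rintegral.
have : (0 <= \int[mu]_(x in cube_set Q) (f x)%:E)%E.
  by apply: integral_ge0 => x _; rewrite lee_fin.
by case: (integral _ _ _) => [r| |]//= _; rewrite leey.
Qed.

Lemma maximal_ge_avg_max w F x : is_weight w -> ((avg_max F w x)%:E <= maximal w x)%E.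
Proof.
move=> [w0 lw].
have avgE Q : avg Q (fun y => `|w y|) = avg Q w.
  by congr (avg Q _); apply/funext => y; rewrite ger0_norm.
have ubQ Q : cube_set Q x -> ((avg Q w)%:E <= maximal w x)%E.
  by move=> Qx; rewrite -avgE; apply: ereal_sup_ubound; exists Q.
have M0 : (0 <= maximal w x)%E.
  pose Q : cube R n := (x : n.-tuple R, PosNum (ltr01 : 0 < 1 :> R)).
  apply: (le_trans _ (ubQ Q (cube_set_corner Q))).
  by rewrite lee_fin; apply: avg_ge0 => y _.
elim: F => [|Q F ih]; first by rewrite /avg_max big_nil.
rewrite avg_max_cons EFin_max ge_max ih andbT indicE.
by have [/set_mem/ubQ|] := boolP (x \in cube_set Q); rewrite ?mulr1 ?mulr0.
Qed.

Lemma avg_max_bound w F : is_weight w -> exists L, forall x, avg_max F w x <= L.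
Proof.
move=> ww; elim: F => [|Q F [L hL]].
  by exists 0 => x; rewrite /avg_max big_nil.
exists (Num.max (avg Q w) L) => x; rewrite avg_max_cons.
rewrite ge_max !le_max hL orbT andbT indicE.
by case: (_ \in _); rewrite ?mulr1 ?mulr0 ?lexx ?avg_weight_ge0.
Qed.

(** The midpoint [r] of [1] and [q]: [r > 1] leaves a conjugate exponent for the oscillation, and
    [r < q] leaves [q / r > 1] for the embedding theorem. *)
Definition embedding_exp (q : R) : R := (q + 1) / 2.
Definition embedding_conj (q : R) : R := embedding_exp q / (embedding_exp q - 1).
Definition embedding_const (q eta : R) : R :=
  (eta^-1 * maximal_const (q / embedding_exp q)) `^ q^-1.

Lemma embedding_exp_gt1 q : 1 < q -> 1 < embedding_exp q.
Proof. by rewrite /embedding_exp => q1; lra. Qed.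

Lemma embedding_conj_gt0 q : 1 < q -> 0 < embedding_conj q.
Proof. by rewrite /embedding_conj /embedding_exp => q1; rewrite divr_gt0//; lra. Qed.

(** Hoelder's inequality with two exponents, indexed by [bool]; the powers of [vol Q] recombine
    because the exponents are conjugate. *)
Lemma avg_mul_le (q H : R) h g Q : 1 < q -> 0 <= H ->
  measurable_fun setT h -> measurable_fun setT g -> (forall x, 0 <= g x) ->
  mu.-integrable (cube_set Q) (EFin \o (fun x => g x `^ embedding_exp q)) ->
  (\int[mu]_(x in cube_set Q) (`|h x| `^ embedding_conj q)%:E <=
    (vol Q * H `^ embedding_conj q)%:E)%E ->
  (\int[mu]_(x in cube_set Q) (`|h x| * g x)%:E <=
    (vol Q * (H * avg Q (fun x => g x `^ embedding_exp q) `^ (embedding_exp q)^-1))%:E)%E.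
Proof.
move=> q1 H0 mh mg g0 iG hH; set r := embedding_exp q; set r' := embedding_conj q.
have r1 : 1 < r := embedding_exp_gt1 q1; have r0 : 0 < r by lra.
have r'0 : 0 < r' := embedding_conj_gt0 q1.
pose theta (i : bool) := if i then r'^-1 else r^-1.
pose F (i : bool) x := if i then `|h x| `^ r' else g x `^ r.
have th0 i : 0 < theta i by case: i; rewrite invr_gt0.
have th1 : \sum_i theta i = 1.
  by rewrite big_bool/= /r' /embedding_conj -/r; field; lra.
have mnh : measurable_fun setT (fun x => `|h x|) by exact: measurableT_comp.
have := @holder_integral R bool theta th0 th1 _ _ mu (cube_set Q) F (measurable_cube_set Q).
have -> : (fun x => (\prod_i F i x `^ theta i)%:E) = (fun x => (`|h x| * g x)%:E).
  apply/funext => x; rewrite big_bool/= -!powRrM !mulfV ?gt_eqF//.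
  by rewrite !powRr1.
move=> /(_ _ _)/le_trans; apply.
- by move=> [] x _; exact: powR_ge0.
- move=> [] /=; apply: measurable_funTS; exact: (measurableT_comp (measurable_powR _)).
have v0 := vol_gt0 Q.
have A0 : 0 <= avg Q (fun x => g x `^ r) by apply: avg_ge0 => x _; exact: powR_ge0.
rewrite big_bool/= (avg_integral iG) poweR_EFin.
apply: (@le_trans _ _ ((vol Q * H `^ r')%:E `^ r'^-1 * ((vol Q * avg Q (fun x => g x `^ r)) `^ r^-1)%:E)%E).
  apply: lee_wpmul2r; first by rewrite lee_fin powR_ge0.
  apply: gt0_ler_poweR; rewrite ?invr_ge0 ?(ltW r'0)// in_itv/= leey andbT.
    by apply: integral_ge0 => x _; rewrite lee_fin powR_ge0.
  by rewrite lee_fin mulr_ge0 ?powR_ge0// ltW.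
rewrite poweR_EFin -EFinM lee_fin.
rewrite (powRM _ (ltW v0) (powR_ge0 H r')) (powRM _ (ltW v0) A0).
rewrite -[(H `^ r') `^ _]powRrM mulfV ?gt_eqF// powRr1// mulrACA.
rewrite -powRD; last by rewrite (gt_eqF v0) implybT.
have -> : r'^-1 + r^-1 = 1 by rewrite -th1 big_bool.
by rewrite powRr1// ltW.
Qed.

(** The factor [h] enters only through the moment bound [H], so plain averages and averages against
    an oscillation are one case. *)
Lemma weighted_embedding (q eta H : R) w f (h : cube R n -> Rn R n -> R) (F : seq (cube R n)) :
  (0 < n)%N -> 1 < q -> 0 < eta -> 0 <= H ->
  is_weight w -> bounded_compact_support f ->
  (forall Q, measurable_fun setT (h Q)) ->
  (forall Q, (\int[mu]_(x in cube_set Q) (`|h Q x| `^ embedding_conj q)%:E <=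
    (vol Q * H `^ embedding_conj q)%:E)%E) ->
  nested [set` F] -> uniq F -> sparse eta [set` F] ->
  ((\sum_(Q <- F) avg Q (fun x => `|h Q x * f x|) `^ q * (vol Q * avg Q w))%:E <=
   ((embedding_const q eta * H)%:E * wLnorm q (maximal w) f) `^ q)%E.
Proof.
move=> n0 q1 eta0 H0 ww [mf [A fA] _] mh hH nF uF spF.
have q0 : 0 < q by lra.
set r := embedding_exp q; have r1 : 1 < r := embedding_exp_gt1 q1.
have r0 : 0 < r by lra.
have t1 : 1 < q / r by rewrite ltr_pdivlMr// /r /embedding_exp; lra.
(* Bounded, as [f] and [avg_max F w] are, so that its powers are integrable on cubes. *)
pose g x := `|f x| * avg_max F w x `^ q^-1.
have M0 x : 0 <= avg_max F w x by exact: avg_max_ge0.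
have g0 x : 0 <= g x by rewrite mulr_ge0// powR_ge0.
have mnf : measurable_fun setT (fun x => `|f x|) by exact: measurableT_comp.
have mg : measurable_fun setT g.
  apply: measurable_funM; first exact: mnf.
  by apply: (measurableT_comp (measurable_powR _)); exact: measurable_avg_max.
pose G x := g x `^ r.
have mG : measurable_fun setT G by exact: (measurableT_comp (measurable_powR _)).
have G0 x : 0 <= G x by exact: powR_ge0.
have iG Q : mu.-integrable (cube_set Q) (EFin \o G).
  have [L hL] := avg_max_bound F ww.
  apply: (@ge0_bounded_integrable _ _ _ _ _ _ ((A * L `^ q^-1) `^ r)).
  - exact: measurable_cube_set.
  - by rewrite measure_cube ltry.
  - exact: measurable_funTS.
  move=> x; rewrite G0/=.
  have A0 : 0 <= A := le_trans (normr_ge0 _) (fA x).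
  have L0 : 0 <= L := le_trans (M0 x) (hL x).
  apply: ge0_ler_powR; rewrite ?nnegrE ?(ltW r0)//.
    by rewrite mulr_ge0// powR_ge0.
  apply: ler_pM => //; first exact: powR_ge0.
  by apply: ge0_ler_powR; rewrite ?nnegrE ?invr_ge0 ?(ltW q0).
have step Q : Q \in F ->
    avg Q (fun x => `|h Q x * f x|) `^ q * (vol Q * avg Q w) <=
    H `^ q * (vol Q * avg Q G `^ (q / r)).
  move=> QF; have v0 := vol_gt0 Q; have a0 := avg_weight_ge0 Q ww.
  set a := avg Q (fun x => `|h Q x * f x|).
  have aa0 : 0 <= a by apply: avg_ge0 => x _; exact: normr_ge0.
  have key : a * avg Q w `^ q^-1 <= H * avg Q G `^ r^-1.
    rewrite -(ler_pM2l v0) -lee_fin.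
    apply: le_trans (avg_mul_le q1 H0 (mh Q) mg g0 (iG Q) (hH Q)).
    have mhf : measurable_fun (cube_set Q) (fun x => `|h Q x * f x|).
      apply: measurable_funTS; apply: measurableT_comp; first exact: normr_measurable.
      by apply: measurable_funM; [exact: mh|exact: mf].
    have l0 : 0 <= avg Q w `^ q^-1 by exact: powR_ge0.
    rewrite (_ : vol Q * _ = avg Q w `^ q^-1 * (vol Q * a)); last by ring.
    rewrite EFinM; apply: (@le_trans _ _ ((avg Q w `^ q^-1)%:E *
      \int[mu]_(x in cube_set Q) (`|h Q x * f x|)%:E)%E).
      by apply: lee_wpmul2l; [rewrite lee_fin|apply: vol_avg_le_integral].
    rewrite -(ge0_RintegralZl mu (measurable_cube_set Q) mhf) //.
    apply: ge0_le_Rintegral; first exact: measurable_cube_set.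
    - by apply: measurable_funM; [exact: measurable_cst|exact: mhf].
    - apply: measurable_funTS; apply: measurable_funM; last exact: mg.
      by apply: measurableT_comp; [exact: normr_measurable|exact: mh].
    - by move=> x _; rewrite mulr_ge0.
    move=> x Qx; rewrite /g normrM mulrC -mulrA ler_wpM2l// ler_wpM2l//.
    apply: ge0_ler_powR; rewrite ?nnegrE ?invr_ge0 ?(ltW q0)//.
    exact: avg_max_le.
  have -> : a `^ q * (vol Q * avg Q w) = vol Q * (a * avg Q w `^ q^-1) `^ q.
    rewrite powRM ?powR_ge0// -powRrM mulVf ?gt_eqF// powRr1//; ring.
  have -> : H `^ q * (vol Q * avg Q G `^ (q / r)) =
      vol Q * (H * avg Q G `^ r^-1) `^ q.
    by rewrite powRM ?powR_ge0// -powRrM [r^-1 * q]mulrC; ring.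
  apply: ler_wpM2l; first exact: ltW v0.
  apply: ge0_ler_powR; [exact: ltW q0|rewrite nnegrE|rewrite nnegrE|exact: key].
    by apply: mulr_ge0; [exact: aa0|exact: powR_ge0].
  by apply: mulr_ge0; [exact: H0|exact: powR_ge0].
have K0 : 0 <= eta^-1 * maximal_const (q / r).
  by rewrite mulr_ge0 ?invr_ge0 ?(ltW eta0)// ltW// maximal_const_gt0.
have I0 : (0 <= \int[mu]_x ((`|f x| `^ q)%:E * maximal w x))%E.
  apply: integral_ge0 => x _; apply: mule_ge0; first by rewrite lee_fin powR_ge0.
  by apply: le_trans (maximal_ge_avg_max [::] x ww); rewrite lee_fin avg_max_ge0.
rewrite poweRM ?poweR_ge0//; last first.
  by rewrite lee_fin mulr_ge0 ?powR_ge0.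
rewrite /wLnorm -poweRrM mulVf ?gt_eqF// poweRe1// poweR_EFin.
rewrite powRM ?powR_ge0// /embedding_const -/r -powRrM mulVf ?gt_eqF// powRr1//.
apply: (@le_trans _ _ ((H `^ q * \sum_(Q <- F) vol Q * avg Q G `^ (q / r))%:E)%E).
  rewrite lee_fin mulr_sumr big_seq [leRHS]big_seq; exact: ler_sum.
rewrite [(eta^-1 * _ * _)]mulrC !EFinM -muleA.
apply: lee_wpmul2l; first by rewrite lee_fin powR_ge0.
apply: (le_trans (carleson t1 eta0 mG G0 iG n0 nF uF spF)).
apply: lee_wpmul2l; first by rewrite lee_fin.
(* Only here does [avg_max F w] give way to [maximal w]. *)
apply: le_integral_ge0 => x; first by rewrite lee_fin powR_ge0.
rewrite /G -powRrM mulrCA mulfV ?gt_eqF// mulr1 /g powRM ?powR_ge0//.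
rewrite -powRrM mulVf ?gt_eqF// powRr1// EFinM.
by apply: lee_wpmul2l; [rewrite lee_fin powR_ge0|exact: maximal_ge_avg_max].
Qed.

Lemma wbmo_cube (q : R) w b : 1 < q -> is_weight w -> wBMO q w b ->
  exists beta : R, [/\ wbmo_norm q w b = beta%:E, 0 <= beta &
    forall Q, (\int[mu]_(x in cube_set Q) (`|b x - avg Q b| `^ q * w x)%:E <=
      (beta `^ q * (vol Q * avg Q w))%:E)%E].
Proof.
move=> q1 ww [lb bfin]; have [w0 lw] := ww; have q0 : 0 < q by lra.
have ub Q : (((((fine (\int[mu]_(x in cube_set Q) (w x)%:E))^-1)%:E *
    \int[mu]_(x in cube_set Q) (`|b x - avg Q b| `^ q * w x)%:E) `^ q^-1) <=
    wbmo_norm q w b)%E.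
  by apply: ereal_sup_ubound; exists Q.
have b0 : (0 <= wbmo_norm q w b)%E by apply: le_trans (ub unit_cube); exact: poweR_ge0.
have bf : wbmo_norm q w b \is a fin_num by rewrite ge0_fin_numE.
exists (fine (wbmo_norm q w b)); split; [by rewrite fineK|exact: fine_ge0|].
move=> Q; have mQ := measurable_cube_set Q.
have mosc : measurable_fun (cube_set Q) (fun x => `|b x - avg Q b| `^ q).
  apply: measurable_funTS; apply: (measurableT_comp (measurable_powR _)).
  apply: measurableT_comp; first exact: normr_measurable.
  by apply: measurable_funB; [exact: lb.1|exact: measurable_cst].
have mw : measurable_fun (cube_set Q) w by apply: measurable_funTS; exact: lw.1.
have I0 : (0 <= \int[mu]_(x in cube_set Q) (`|b x - avg Q b| `^ q * w x)%:E)%E.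
  by apply: integral_ge0 => x _; rewrite lee_fin mulr_ge0 ?powR_ge0.
have := ub Q; rewrite weight_integral//=.
set W := vol Q * avg Q w; have W0 : 0 <= W.
  by rewrite mulr_ge0 ?avg_weight_ge0// ltW// vol_gt0.
(* If [w(Q) = 0], the inverse in the norm is [0] and the norm says nothing about [Q]; but then [w]
   vanishes almost everywhere on [Q]. *)
have [W00 _|Wn0] := eqVneq W 0.
  rewrite W00 mulr0.
  have : ae_eq mu (cube_set Q) (EFin \o w) (cst 0%E).
    apply/ae_eq_integral_abs; [exact: mQ|by apply/measurable_EFinP|].
    under eq_integral => x _ do rewrite gee0_abs ?lee_fin//.
    by rewrite weight_integral// -/W W00.
  move=> ae0; rewrite (@ge0_ae_eq_integral _ _ _ _ (cube_set Q) _ (cst 0%E)).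
  - by rewrite integral0.
  - exact: mQ.
  - by apply/measurable_EFinP; apply: measurable_funM.
  - exact: measurable_cst.
  - by move=> x _; rewrite lee_fin mulr_ge0 ?powR_ge0.
  - by [].
  - by apply: filterS ae0 => x /= wx Qx; move: (wx Qx) => [->]; rewrite mulr0.
have {Wn0}Wp : 0 < W by rewrite lt_neqAle eq_sym Wn0.
move=> /(@gt0_ler_poweR _ q (ltW q0) _ _) h.
have {h} := h _ _; rewrite !in_itv/= !leey !andbT poweR_ge0 b0 => /(_ isT isT).
rewrite -poweRrM mulVf ?gt_eqF// poweRe1; last first.
  by rewrite mule_ge0// lee_fin invr_ge0.
rewrite -[X in (_ <= X `^ _)%E -> _](fineK bf) poweR_EFin.
rewrite lee_pdivrMl// muleC -EFinM.
by [].
Qed.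

End weighted.

(** * Products and concave powers of extended reals *)

Section products.
Context {R : realType}.

Lemma powR_prod (I : Type) (s : seq I) (x : I -> R) (p : R) : (forall i, 0 <= x i) ->
  (\prod_(i <- s) x i) `^ p = \prod_(i <- s) x i `^ p.
Proof.
move=> x0; elim: s => [|i s ih]; first by rewrite !big_nil powR1.
by rewrite !big_cons powRM ?ih// prodr_ge0.
Qed.

Lemma poweR_prod (I : Type) (s : seq I) (x : I -> \bar R) (p : R) :
  (forall i, 0 <= x i)%E ->
  ((\prod_(i <- s) x i) `^ p = \prod_(i <- s) x i `^ p)%E.
Proof.
move=> x0; elim: s => [|i s ih]; first by rewrite !big_nil poweR1r.
by rewrite !big_cons poweRM ?ih// prode_ge0.
Qed.

Lemma lee_prod (I : Type) (s : seq I) (x y : I -> \bar R) :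
  (forall i, 0 <= x i <= y i)%E -> (\prod_(i <- s) x i <= \prod_(i <- s) y i)%E.
Proof.
move=> xy; have x0 i : (0 <= x i)%E by have /andP[] := xy i.
elim: s => [|i s ih]; first by rewrite !big_nil.
rewrite !big_cons lee_pmul//; first exact: prode_ge0.
by have /andP[] := xy i.
Qed.

Lemma lee_poweR (x y : \bar R) (r : R) : 0 <= r -> (0 <= x)%E -> (x <= y)%E ->
  (x `^ r <= y `^ r)%E.
Proof.
move=> r0 x0 xy; apply: gt0_ler_poweR => //; rewrite in_itv/= leey andbT//.
exact: le_trans xy.
Qed.

(** For [z = x] and [z = y] the proportion [z / (x + y)] lies in the unit interval, hence is at most
    its [p]-th power; the two proportions add up to [1]. *)
Lemma poweR_addr_le (x y : \bar R) (p : R) : 0 < p -> p <= 1 -> (0 <= x)%E -> (0 <= y)%E ->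
  ((x + y) `^ p <= x `^ p + y `^ p)%E.
Proof.
move=> p0 p1; case: x => [x| |]//; last first.
  move=> _ y0; rewrite addye ?poweRyr ?gt_eqF ?(lt_le_trans _ y0)//.
  by rewrite addye ?leey// gt_eqF// (lt_le_trans _ (poweR_ge0 _ _)).
case: y => [y| |]//; last first.
  by move=> x0 _; rewrite addey// poweRyr ?gt_eqF// addey// poweR_EFin.
rewrite !lee_fin => x0 y0.
change (((x + y) `^ p)%:E <= (x `^ p + y `^ p)%:E)%E; rewrite lee_fin.
have : 0 <= x + y by rewrite addr_ge0.
rewrite le_eqVlt => /predU1P[<-|xy0].
  by rewrite powR0 ?gt_eqF// addr_ge0 ?powR_ge0.
have main (z : R) : 0 <= z -> z <= x + y -> (x + y) `^ p * (z / (x + y)) <= z `^ p.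
  move=> z0 zxy; rewrite -[z in leRHS](divfK (lt0r_neq0 xy0)) mulrC powRM ?divr_ge0 ?(ltW xy0)//.
  rewrite ler_wpM2r ?powR_ge0//.
  move: z0; rewrite le_eqVlt => /predU1P[<-|z0]; first by rewrite mul0r powR_ge0.
  by apply: ger1_powR => //; rewrite divr_gt0//= ler_pdivrMr// mul1r.
have := lerD (main x x0 _) (main y y0 _); rewrite -mulrDr -mulrDl divff ?gt_eqF// mulr1.
by apply; rewrite ?lerDl ?lerDr.
Qed.

Lemma poweR_sum_le (I : Type) (s : seq I) (x : I -> \bar R) (p : R) : 0 < p -> p <= 1 ->
  (forall i, 0 <= x i)%E -> ((\sum_(i <- s) x i) `^ p <= \sum_(i <- s) x i `^ p)%E.
Proof.
move=> p0 p1 x0; elim: s => [|i s ih]; first by rewrite !big_nil poweR0r// gt_eqF.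
rewrite !big_cons (le_trans (poweR_addr_le _ _ _ _))//; first exact: sume_ge0.
exact: leeD2l.
Qed.

(** The right side is written as a [p]-th power, so that the limit is taken in an inequality between
    sums and continuity of the power is not involved. *)
Lemma poweR_series_le (x : nat -> \bar R) (p : R) : 0 < p -> p <= 1 ->
  (forall i, 0 <= x i)%E -> ((\sum_(k <oo) x k) `^ p <= \sum_(k <oo) x k `^ p)%E.
Proof.
move=> p0 p1 x0; set K := (X in (_ <= X)%E).
have K0 : (0 <= K)%E by apply: nneseries_ge0 => k _ _; exact: poweR_ge0.
have -> : K = ((K `^ p^-1) `^ p)%E by rewrite -poweRrM mulVf ?gt_eqF// poweRe1.
apply: lee_poweR; [exact: ltW|by apply: nneseries_ge0|].
apply: lime_le; first by apply: is_cvg_nneseries => k _ _; exact: x0.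
apply: nearW => N; set s := (X in (X <= _)%E).
have s0 : (0 <= s)%E by apply: sume_ge0.
have -> : s = ((s `^ p) `^ p^-1)%E by rewrite -poweRrM mulfV ?gt_eqF// poweRe1.
apply: lee_poweR; [by rewrite invr_ge0 ltW|exact: poweR_ge0|].
rewrite /s; apply: (le_trans (poweR_sum_le _ p0 p1 x0)).
by apply: nneseries_lim_ge => k _ _; exact: poweR_ge0.
Qed.

End products.

Section enumeration.
Context {R : realType}.

(** The predicate [P] marks the indices in use: [S] may be finite and its numbering may have gaps,
    where [e] takes a meaningless value. *)
Lemma esum_enum (T : choiceType) (S : set T) (t0 : T) : countable S ->
  exists (e : nat -> T) (P : pred nat),
    [/\ forall k, P k -> S (e k), {in P &, injective e} &
        forall F : T -> \bar R, (forall t, 0 <= F t)%E ->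
          (\esum_(t in S) F t = \sum_(k <oo) if P k then F (e k) else 0)%E].
Proof.
move=> /countable_injP[f finj].
have /choice[e eP] : forall k, exists t, (exists2 s, S s & f s = k) -> S t /\ f t = k.
  move=> k; have [[s Ss fs]|nk] := pselect (exists2 s, S s & f s = k).
    by exists s.
  by exists t0.
pose P k := `[< exists2 s, S s & f s = k >].
have PS k : P k -> S (e k) by move=> /asboolP/eP[].
have einj : {in P &, injective e}.
  move=> i j /asboolP/eP[_ fi] /asboolP/eP[_ fj] eij.
  by rewrite -fi -fj eij.
exists e, P; split => // F F0.
have -> : S = e @` [set k | P k].
  apply/seteqP; split => [t St|_ [k /PS + <-]//].
  have Pft : P (f t) by apply/asboolP; exists t.
  exists (f t) => //; have [Se fe] := eP (f t) (asboolW Pft).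
  by apply: finj; rewrite ?inE.
rewrite esum_pred_image; [exact: eseries_mkcond|by []|].
by move=> i j /set_mem Pi /set_mem Pj; exact: einj.
Qed.

End enumeration.

(** * Hoelder's inequality on each cube and over the cubes *)

Section holder_cubes.
Context d (T : measurableType d) (R : realType) (I : finType) (J : eqType).
Variables (mu : {measure set T -> \bar R}) (D : J -> set T).
Variables (p_ : I -> R) (p : R).
Hypotheses (p_gt0 : forall s, 0 < p_ s) (p0 : 0 < p)
  (theta_sum : \sum_s p / p_ s = 1).
Variables (w : I -> T -> R) (a : I -> J -> T -> R) (A W : I -> J -> R).
Variables (beta : I -> R) (Y : I -> \bar R).
Hypothesis mD : forall Q, measurable (D Q).
Hypothesis w0 : forall s x, 0 <= w s x.
Hypothesis mw : forall s, measurable_fun setT (w s).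
Hypothesis a0 : forall s Q x, 0 <= a s Q x.
Hypothesis ma : forall s Q, measurable_fun setT (a s Q).
Hypothesis A0 : forall s Q, 0 <= A s Q.
Hypothesis W0 : forall s Q, 0 <= W s Q.
Hypothesis beta0 : forall s, 0 <= beta s.
Hypothesis Y0 : forall s, (0 <= Y s)%E.
Hypothesis aW : forall s Q, (\int[mu]_(x in D Q) (a s Q x `^ p_ s * w s x)%:E <=
  (beta s `^ p_ s * W s Q)%:E)%E.

Let theta s := p / p_ s.
Let theta_gt0 s : 0 < theta s. Proof. by rewrite divr_gt0. Qed.
Let thetaE s : p_ s * theta s = p. Proof. by rewrite /theta mulrC divfK// gt_eqF. Qed.

(** Raising the product of [a ^ p_s] and [w] to the power [p / p_s] gives [a ^ p] times
    [w ^ (p / p_s)], which is how the product weight splits among the Hoelder factors. *)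
Lemma holder_cube Q :
  (\int[mu]_(x in D Q) ((\prod_s (a s Q x * A s Q)) `^ p * \prod_s w s x `^ (p / p_ s))%:E <=
   (\prod_s (beta s `^ p * (A s Q `^ p_ s * W s Q) `^ theta s))%:E)%E.
Proof.
pose F s x := A s Q `^ p_ s * (a s Q x `^ p_ s * w s x).
have F0 s x : 0 <= F s x by rewrite !mulr_ge0 ?powR_ge0.
have maw s : measurable_fun setT (fun x => a s Q x `^ p_ s * w s x).
  by apply: measurable_funM => //; exact: (measurableT_comp (measurable_powR _)).
have -> : (fun x => ((\prod_s (a s Q x * A s Q)) `^ p * \prod_s w s x `^ (p / p_ s))%:E) =
    (fun x => (\prod_s F s x `^ theta s)%:E).
  apply/funext => x; congr EFin; rewrite powR_prod; last by move=> s; rewrite mulr_ge0.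
  rewrite -big_split/=; apply: eq_bigr => s _.
  rewrite /F !powRM ?powR_ge0 ?mulr_ge0 ?powR_ge0// -!powRrM thetaE.
  by rewrite mulrA [A s Q `^ p * _]mulrC.
apply: (le_trans (holder_integral theta_gt0 theta_sum mu (mD Q) _ _)).
- by move=> s x _; exact: F0.
- move=> s; apply: measurable_funTS; apply: measurable_funM => //.
have FW s : (\int[mu]_(x in D Q) (F s x)%:E <=
    (A s Q `^ p_ s * (beta s `^ p_ s * W s Q))%:E)%E.
  rewrite /F ge0_RintegralZl ?powR_ge0//; last 2 first.
  - exact: measurable_funTS.
  - by move=> x _; rewrite mulr_ge0 ?powR_ge0.
  by rewrite EFinM; apply: lee_wpmul2l; rewrite ?lee_fin ?powR_ge0.
rewrite -prodEFin; apply: lee_prod => s; rewrite poweR_ge0/=.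
apply: (le_trans (lee_poweR (ltW (theta_gt0 s)) _ (FW s))).
  by apply: integral_ge0 => x _; rewrite lee_fin.
rewrite poweR_EFin lee_fin [_ * (_ * W s Q)]mulrCA.
by rewrite [in leLHS]powRM ?mulr_ge0 ?powR_ge0// -[(beta s `^ _) `^ _]powRrM thetaE.
Qed.

(** The factors [beta s] do not depend on the cube and leave the sum; the discrete inequality with
    the same exponents does the rest. *)
Lemma holder_cubes (F : seq J) :
  (forall s, (\sum_(Q <- F) A s Q `^ p_ s * W s Q)%:E <= Y s `^ p_ s)%E ->
  (\sum_(Q <- F)
    \int[mu]_(x in D Q) ((\prod_s (a s Q x * A s Q)) `^ p * \prod_s w s x `^ (p / p_ s))%:E <=
   (\prod_s ((beta s)%:E * Y s)) `^ p)%E.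
Proof.
move=> FY; apply: (le_trans (lee_sum _ (fun Q _ => holder_cube Q))).
rewrite sumEFin; under eq_bigr do rewrite big_split/=.
rewrite -mulr_sumr poweR_prod; last by move=> s; rewrite mule_ge0// lee_fin.
apply: (@le_trans _ _ ((\prod_s beta s `^ p) *
    \prod_s (\sum_(Q <- F) A s Q `^ p_ s * W s Q) `^ theta s)%:E).
  rewrite lee_fin ler_wpM2l//; first by apply: prodr_ge0 => s _; exact: powR_ge0.
  apply: (holder_sum theta_gt0 theta_sum F (x := fun s Q => A s Q `^ p_ s * W s Q)).
  by move=> s Q; rewrite mulr_ge0 ?powR_ge0.
rewrite -big_split/= -prodEFin; apply: lee_prod => s.
have S0 : 0 <= \sum_(Q <- F) A s Q `^ p_ s * W s Q.
  by apply: sumr_ge0 => Q _; rewrite mulr_ge0 ?powR_ge0.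
rewrite lee_fin mulr_ge0 ?powR_ge0//= poweRM ?lee_fin// EFinM poweR_EFin.
apply: lee_wpmul2l; first by rewrite lee_fin powR_ge0.
rewrite -poweR_EFin -[in leRHS](thetaE s) poweRrM.
by apply: lee_poweR; [exact: ltW|rewrite lee_fin|exact: FY].
Qed.

End holder_cubes.

Section extension.
Variables (l m : nat) (lm : (l <= m)%N) (X : Type) (d : X) (v : 'I_l -> X).

(** Extends a family on the [l] commutator slots to all [m] slots, so that both products in a sparse
    term become one. *)
Definition extend_ord (s : 'I_m) : X := oapp v d (insub (val s)).

Lemma extend_ord_widen i : extend_ord (widen_ord lm i) = v i.
Proof. by rewrite /extend_ord /= valK. Qed.

Lemma extend_ord_out (s : 'I_m) : (l <= s)%N -> extend_ord s = d.
Proof. by move=> ls; rewrite /extend_ord insubN// -leqNgt. Qed.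

End extension.

Lemma ord_widen_cases (l m : nat) (lm : (l <= m)%N) (s : 'I_m) :
  (exists i, s = widen_ord lm i) \/ (l <= s)%N.
Proof.
have [ls|sl] := leqP l s; [by right|left].
by exists (Ordinal sl); exact: val_inj.
Qed.

(** * The bound for a sparse family and for the sparse domination *)

Section multilinear.
Context {R : realType} {n m l : nat}.
Local Notation mu := (@lebesgue_Rn R n).
Local Notation fct := (Rn R n -> R).
Variables (lm : (l <= m)%N) (p_ : 'I_m -> R) (p eta : R).
Hypotheses (n_gt0 : (0 < n)%N) (p_gt1 : forall s, 1 < p_ s) (p_gt0 : 0 < p)
  (theta_sum : \sum_s p / p_ s = 1) (eta_gt0 : 0 < eta).

(** The sum [1 + bmo_moment_const] covers both inner factors, the constant [1] and the oscillation,
    whatever [gamma] is. *)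
Definition factor_const (s : 'I_m) : R :=
  embedding_const (p_ s) eta * (1 + bmo_moment_const (n := n) (embedding_conj (p_ s))).

Lemma embedding_const_gt0 q : 1 < q -> 0 < embedding_const q eta.
Proof.
move=> q1; rewrite powR_gt0// mulr_gt0 ?invr_gt0// maximal_const_gt0//.
by rewrite ltr_pdivlMr /embedding_exp; lra.
Qed.

Lemma factor_const_gt0 s : 0 < factor_const s.
Proof.
rewrite mulr_gt0 ?embedding_const_gt0// addr_gt0// bmo_moment_const_gt0//.
exact: embedding_conj_gt0.
Qed.

Variables (w : 'I_m -> fct) (b : 'I_l -> fct) (f : 'I_m -> fct).
Hypothesis ww : forall s, is_weight (w s).
Hypothesis wb : forall i, wBMO (p_ (widen_ord lm i)) (w (widen_ord lm i)) (b i) /\ BMO (b i).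
Hypothesis ff : forall s, bounded_compact_support (f s).

Definition sparse_term (gamma : {ffun 'I_l -> bool}) (Q : cube R n) (x : Rn R n) : R :=
  (\prod_(s < l) sparse_factor (b s) (f (widen_ord lm s)) Q (gamma s) x) *
  (\prod_(s < m | (l <= s)%N) avg Q (fun y => `|f s y|)).

Section fixed_gamma.
Variable gamma : {ffun 'I_l -> bool}.

(* The two kinds of factor and the absent commutators (slots [l <= s]) are all
   of the form [outer s Q x * <|inner s Q f_s|>_Q]. *)
Definition outer (s : 'I_m) (Q : cube R n) (x : Rn R n) : R :=
  extend_ord 1 (fun i => if gamma i then `|b i x - avg Q (b i)| else 1) s.
Definition inner (s : 'I_m) (Q : cube R n) (x : Rn R n) : R :=
  extend_ord 1 (fun i => if gamma i then 1 else b i x - avg Q (b i)) s.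
Definition inner_avg (s : 'I_m) (Q : cube R n) : R := avg Q (fun y => `|inner s Q y * f s y|).

Let aw s i Q x : s = widen_ord lm i ->
  outer s Q x = if gamma i then `|b i x - avg Q (b i)| else 1.
Proof. by move=> ->; rewrite /outer extend_ord_widen. Qed.
Let ao (s : 'I_m) Q x : (l <= s)%N -> outer s Q x = 1.
Proof. by move=> ls; rewrite /outer extend_ord_out. Qed.
Let hw s i Q x : s = widen_ord lm i ->
  inner s Q x = if gamma i then 1 else b i x - avg Q (b i).
Proof. by move=> ->; rewrite /inner extend_ord_widen. Qed.
Let ho (s : 'I_m) Q x : (l <= s)%N -> inner s Q x = 1.
Proof. by move=> ls; rewrite /inner extend_ord_out. Qed.

Lemma sparse_termE Q x : sparse_term gamma Q x = \prod_s (outer s Q x * inner_avg s Q).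
Proof.
rewrite /sparse_term [RHS](bigID (fun s : 'I_m => (s < l)%N))/=; congr (_ * _).
  rewrite (big_ord_narrow lm); apply: eq_bigr => i _.
  rewrite (aw _ _ erefl) /inner_avg /sparse_factor; case gi : (gamma i); last first.
    rewrite mul1r; congr (avg Q _); apply/funext => y.
    by rewrite (hw _ _ erefl) gi.
  congr (_ * avg Q _); apply/funext => y.
  by rewrite (hw _ _ erefl) gi mul1r.
apply: eq_big => [s|s ls]; first by rewrite -leqNgt.
rewrite ao// mul1r /inner_avg; congr (avg Q _); apply/funext => y.
by rewrite ho// mul1r.
Qed.

Let mdev i c : measurable_fun setT (fun x => b i x - c).
Proof. by apply: measurable_funB; [exact: (wb i).2.1.1|exact: measurable_cst]. Qed.

(** Each slot charges one norm: the weighted one to [beta] if the oscillation is outside, the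
    unweighted one to [Bs] if it is inside. The product of all charges is then the [gamma] term of
    the maximum [bmo_star]. *)
Lemma factors_le : exists beta Bs : 'I_m -> R,
  [/\ forall s, 0 <= beta s, forall s, 0 <= Bs s,
      forall s Q, (\int[mu]_(x in cube_set Q) (outer s Q x `^ p_ s * w s x)%:E <=
        (beta s `^ p_ s * (vol Q * avg Q (w s)))%:E)%E,
      forall s Q, (\int[mu]_(x in cube_set Q) (`|inner s Q x| `^ embedding_conj (p_ s))%:E <=
        (vol Q * ((1 + bmo_moment_const (n := n) (embedding_conj (p_ s))) * Bs s)
          `^ embedding_conj (p_ s))%:E)%E &
      ((\prod_s (beta s * Bs s))%:E <= bmo_star lm p_ w b)%E].
Proof.
have /choice[be beP] i := wbmo_cube (p_gt1 _) (ww _) (wb i).1.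
have /choice[bo boP] i := bmo_normP (wb i).2.
pose beta := extend_ord (m := m) 1 (fun i => if gamma i then be i else 1).
pose Bs := extend_ord (m := m) 1 (fun i => if gamma i then 1 else bo i).
have K0 s : 0 < bmo_moment_const (R := R) (n := n) (embedding_conj (p_ s)).
  by rewrite bmo_moment_const_gt0// embedding_conj_gt0.
have one s Q : (\int[mu]_(x in cube_set Q) (`|1 : R| `^ embedding_conj (p_ s))%:E <=
    (vol Q * ((1 + bmo_moment_const (n := n) (embedding_conj (p_ s))) * 1)
    `^ embedding_conj (p_ s))%:E)%E.
  rewrite normr1 powR1 integral_cst; last exact: measurable_cube_set.
  rewrite mul1e [leLHS]measure_cube lee_fin ler_peMr ?(ltW (vol_gt0 Q))// mulr1.
  have c0 := embedding_conj_gt0 (p_gt1 s).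
  apply: (@le_trans _ _ (1 `^ embedding_conj (p_ s))); first by rewrite powR1.
  rewrite ge0_ler_powR ?nnegrE ?(ltW c0)//; last by rewrite lerDl ltW.
  by rewrite addr_ge0// ltW.
have onew s Q : (\int[mu]_(x in cube_set Q) ((1 : R) `^ p_ s * w s x)%:E <=
    ((1 : R) `^ p_ s * (vol Q * avg Q (w s)))%:E)%E.
  rewrite powR1 mul1r -weight_integral//.
  by under eq_integral do rewrite mul1r.
exists beta, Bs; split.
- move=> s; have [[i ->]|ls] := ord_widen_cases lm s;
    rewrite /beta ?extend_ord_widen ?extend_ord_out//.
  by case: ifP => // _; have [] := beP i.
- move=> s; have [[i ->]|ls] := ord_widen_cases lm s;
    rewrite /Bs ?extend_ord_widen ?extend_ord_out//.
  by case: ifP => // _; have [] := boP i.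
- move=> s Q; have [[i ->]|ls] := ord_widen_cases lm s;
    rewrite /beta ?extend_ord_widen ?extend_ord_out//.
    under eq_integral do rewrite (aw _ _ erefl).
    by case: ifP => _; [have [_ _] := beP i; exact|exact: onew].
  by under eq_integral do rewrite ao//; exact: onew.
- move=> s Q; have [[i ->]|ls] := ord_widen_cases lm s;
    rewrite /Bs ?extend_ord_widen ?extend_ord_out//.
    under eq_integral do rewrite (hw _ _ erefl).
    case: ifP => _; first exact: one.
    have [boE bo0 _] := boP i; set t := widen_ord lm i.
    have c0 := embedding_conj_gt0 (p_gt1 t).
    apply: (le_trans (bmo_moment Q n_gt0 c0 (wb i).2 boE)).
    rewrite lee_fin; apply: ler_wpM2l; first exact: ltW (vol_gt0 Q).
    have k0 := ltW (K0 t).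
    apply: ge0_ler_powR; rewrite ?nnegrE ?(ltW c0)//.
    + by rewrite mulr_ge0.
    + by rewrite mulr_ge0// addr_ge0.
    + by rewrite ler_wpM2r// lerDr.
  by under eq_integral do rewrite ho//; exact: one.
have -> : \prod_s (beta s * Bs s) = \prod_(i < l) (if gamma i then be i else bo i).
  rewrite (bigID (fun s : 'I_m => (s < l)%N))/= [X in _ * X]big1 ?mulr1.
    rewrite (big_ord_narrow lm); apply: eq_bigr => i _.
    by rewrite /beta /Bs !extend_ord_widen; case: ifP; rewrite (mulr1, mul1r).
  by move=> s; rewrite -leqNgt => ls; rewrite /beta /Bs !extend_ord_out// mulr1.
rewrite (bigID (fun i => gamma i))/= EFinM -!prodEFin.
rewrite (eq_bigr (fun i => wbmo_norm (p_ (widen_ord lm i)) (w (widen_ord lm i)) (b i))); last first.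
  by move=> i gi; rewrite gi; have [->] := beP i.
rewrite [X in (_ * X)%E](eq_bigr (fun i => bmo_norm (b i))); last first.
  by move=> i /negbTE gi; rewrite gi; have [->] := boP i.
rewrite /bmo_star.
exact: (le_bigmax_cond _ (fun gamma : {ffun 'I_l -> bool} => _)).
Qed.

Lemma wLnorm_ge0 q (v : Rn R n -> \bar R) (g : fct) : (0 <= wLnorm q v g)%E.
Proof. exact: poweR_ge0. Qed.

Lemma sparse_sum_le (F : seq (cube R n)) :
  nested [set` F] -> uniq F -> sparse eta [set` F] ->
  (\sum_(Q <- F) \int[mu]_(x in cube_set Q)
      (sparse_term gamma Q x `^ p * \prod_s w s x `^ (p / p_ s))%:E <=
   ((\prod_s factor_const s)%:E * bmo_star lm p_ w b *
     \prod_s wLnorm (p_ s) (maximal (w s)) (f s)) `^ p)%E.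
Proof.
move=> nF uF spF; have [beta [Bs [be0 Bs0 aW hH prodB]]] := factors_le.
pose H s := (1 + bmo_moment_const (n := n) (embedding_conj (p_ s))) * Bs s.
have H0 s : 0 <= H s.
  rewrite mulr_ge0// addr_ge0// ltW// bmo_moment_const_gt0//.
  exact: embedding_conj_gt0.
pose N s := wLnorm (p_ s) (maximal (w s)) (f s).
pose Y s := ((embedding_const (p_ s) eta * H s)%:E * N s)%E.
have Y0 s : (0 <= Y s)%E.
  by rewrite mule_ge0 ?wLnorm_ge0// lee_fin mulr_ge0// ltW// embedding_const_gt0.
have mh s Q : measurable_fun setT (inner s Q).
  have [[i ->]|ls] := ord_widen_cases lm s.
    rewrite (_ : inner _ Q = fun x => if gamma i then 1 else b i x - avg Q (b i)).
      by case: (gamma i); [exact: measurable_cst|exact: mdev].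
    by apply/funext => x; rewrite (hw _ _ erefl).
  rewrite (_ : inner _ Q = cst 1); first exact: measurable_cst.
  by apply/funext => x; rewrite ho.
have ma s Q : measurable_fun setT (outer s Q).
  have [[i ->]|ls] := ord_widen_cases lm s.
    rewrite (_ : outer _ Q = fun x => if gamma i then `|b i x - avg Q (b i)| else 1).
      case: (gamma i); last exact: measurable_cst.
      by apply: measurableT_comp; [exact: normr_measurable|exact: mdev].
    by apply/funext => x; rewrite (aw _ _ erefl).
  rewrite (_ : outer _ Q = cst 1); first exact: measurable_cst.
  by apply/funext => x; rewrite ao.
have a0 s Q x : 0 <= outer s Q x.
  have [[i ->]|ls] := ord_widen_cases lm s; last by rewrite ao.
  by rewrite (aw _ _ erefl); case: ifP.
have A0 s Q : 0 <= inner_avg s Q by apply: avg_ge0 => x _; exact: normr_ge0.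
have W0 s Q : 0 <= vol Q * avg Q (w s).
  by rewrite mulr_ge0 ?avg_weight_ge0// ltW// vol_gt0.
under [leLHS]eq_bigr do under eq_integral do rewrite sparse_termE.
apply: (le_trans (@holder_cubes _ _ R _ (cube R n) mu cube_set p_ p
  (fun s => lt_trans ltr01 (p_gt1 s)) p_gt0 theta_sum w outer inner_avg
  (fun s Q => vol Q * avg Q (w s)) beta Y (@measurable_cube_set R n) (fun s => (ww s).1) (fun s => (ww s).2.1)
  a0 ma A0 W0 be0 Y0 aW F _)).
  move=> s; exact: weighted_embedding.
apply: lee_poweR; [exact: ltW|by apply: prode_ge0 => s _; rewrite mule_ge0// lee_fin|].
have -> : (\prod_s ((beta s)%:E * Y s) =
    (\prod_s factor_const s)%:E * (\prod_s (beta s * Bs s))%:E * \prod_s N s)%E.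
  rewrite -!prodEFin -!big_split/=; apply: eq_bigr => s _.
  by rewrite /Y /H /factor_const muleA -!EFinM; congr (_%:E * _)%E; ring.
apply: lee_wpmul2r; first by apply: prode_ge0 => s _; exact: wLnorm_ge0.
apply: lee_wpmul2l => //; rewrite lee_fin; apply: prodr_ge0 => s _.
exact: ltW (factor_const_gt0 s).
Qed.

End fixed_gamma.
(** Fewer cubes cover less, by monotonicity of the outer measure. *)
Lemma sparse_subfamily (S : set (cube R n)) (F : seq (cube R n)) :
  sparse eta S -> [set` F] `<=` S ->
  sparse eta [set` F].
Proof.
move=> spS FS Q QF; apply: le_trans (spS Q (FS _ QF)).
apply: le_mu_ext => x [P [PF PQ] Px]; exists P => //; split=> //; exact: FS.
Qed.

Let nu x := \prod_s w s x `^ (p / p_ s).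
Let bound := ((\prod_s factor_const s)%:E * bmo_star lm p_ w b *
  \prod_s wLnorm (p_ s) (maximal (w s)) (f s))%E.

Lemma sparse_term_ge0 gamma Q x : 0 <= sparse_term gamma Q x.
Proof.
rewrite mulr_ge0// prodr_ge0// => s _; last by apply: avg_ge0 => y _; exact: normr_ge0.
rewrite /sparse_factor; case: ifP => _; last by apply: avg_ge0 => y _; exact: normr_ge0.
by rewrite mulr_ge0//; apply: avg_ge0 => y _; exact: normr_ge0.
Qed.

Lemma measurable_sparse_term gamma Q : measurable_fun setT (sparse_term gamma Q).
Proof.
apply: measurable_funM; last exact: measurable_cst.
apply: measurable_prod => i _; rewrite /sparse_factor.
case: (gamma i); last exact: measurable_cst.
apply: measurable_funM; last exact: measurable_cst.
apply: measurableT_comp; first exact: normr_measurable.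
by apply: measurable_funB; [exact: (wb i).2.1.1|exact: measurable_cst].
Qed.

Let nu_ge0 x : 0 <= nu x.
Proof. by apply: prodr_ge0 => s _; exact: powR_ge0. Qed.

Let measurable_nu : measurable_fun setT nu.
Proof.
apply: measurable_prod => s _; apply: (measurableT_comp (measurable_powR _)).
exact: (ww s).2.1.
Qed.

(** Enumerating the countable family turns the sum into a series, so the majorant [Z] is measurable.
    The power enters termwise, and the integrals of the partial sums are bounded independently of
    the number of terms. *)
Lemma sparse_family_bound gamma (S : set (cube R n)) : p <= 1 ->
  sparse_in_lattice eta S ->
  exists Z : Rn R n -> \bar R,
    [/\ measurable_fun setT Z, forall x, (0 <= Z x)%E,
        forall x, ((\esum_(Q in S) (sparse_term gamma Q x * \1_(cube_set Q) x)%:E) `^ p *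
          (nu x)%:E <= Z x)%E &
        (\int[mu]_x Z x <= bound `^ p)%E].
Proof.
move=> p1 [spS [D latD SD]].
have cS : countable S := sub_countable (subset_card_le SD) (dyadic_lattice_countable latD).
have nS : nested S by move=> P Q /SD DP /SD DQ; exact: (dyadic_lattice_nested latD).
have [e [P [PS einj esumE]]] := @esum_enum R _ S unit_cube cS.
pose u Q x := sparse_term gamma Q x * \1_(cube_set Q) x.
have u0 Q x : 0 <= u Q x by rewrite mulr_ge0 ?sparse_term_ge0.
pose z k x := if P k then u (e k) x `^ p * nu x else 0.
have z0 k x : (0 <= (z k x)%:E)%E.
  by rewrite lee_fin /z; case: ifP => // _; rewrite mulr_ge0 ?powR_ge0 ?nu_ge0.
have mz k : measurable_fun setT (fun x => (z k x)%:E).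
  apply/measurable_EFinP; rewrite /z; case: (P k); last exact: measurable_cst.
  apply: measurable_funM; last exact: measurable_nu.
  apply: (measurableT_comp (measurable_powR _)); apply: measurable_funM.
    exact: measurable_sparse_term.
  exact/measurable_indic/measurable_cube_set.
exists (fun x => \sum_(k <oo) (z k x)%:E)%E; split.
- by apply: ge0_emeasurable_sum => k *; [exact: z0|exact: mz].
- by move=> x; apply: nneseries_ge0 => k _ _; exact: z0.
- move=> x; rewrite esumE; last by move=> Q; rewrite lee_fin u0.
  have v0 k : (0 <= if P k then (u (e k) x)%:E else 0)%E.
    by case: ifP => // _; rewrite lee_fin.
  apply: (@le_trans _ _ ((\sum_(k <oo) (if P k then (u (e k) x)%:E else 0) `^ p) * (nu x)%:E)%E).
    by apply: lee_wpmul2r; [rewrite lee_fin; exact: nu_ge0|exact: poweR_series_le].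
  rewrite muleC -nneseriesZl; last by move=> k _; exact: poweR_ge0.
  apply: lee_nneseries => k _; first by rewrite mule_ge0 ?poweR_ge0// lee_fin; exact: nu_ge0.
  rewrite /z; case: ifP => _; last by rewrite poweR0r ?gt_eqF// mule0.
  by rewrite muleC poweR_EFin.
rewrite integral_nneseries; [|exact: measurableT|exact: mz|by move=> k x _; exact: z0].
apply: lime_le.
  by apply: is_cvg_nneseries => k _ _; apply: integral_ge0 => x _; exact: z0.
apply: nearW => N.
have zE k : (\int[mu]_x (z k x)%:E = if P k then
    \int[mu]_(x in cube_set (e k)) (sparse_term gamma (e k) x `^ p * nu x)%:E else 0)%E.
  rewrite /z; case: (P k); last by rewrite integral0.
  rewrite [RHS]integral_mkcond; apply: eq_integral => x _.
  rewrite patchE /u indicE; case: (x \in _); first by rewrite mulr1.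
  by rewrite mulr0 powR0 ?gt_eqF// mul0r.
rewrite (eq_bigr _ (fun k _ => zE k)) -big_mkcond/= -big_filter.
rewrite -(big_map e xpredT (fun Q =>
  \int[mu]_(x in cube_set Q) (sparse_term gamma Q x `^ p * nu x)%:E)%E).
set F := map _ _.
have FS : [set` F] `<=` S.
  by move=> Q /mapP[k]; rewrite mem_filter => /andP[Pk _] ->; exact: PS.
apply: sparse_sum_le.
- by move=> Q1 Q2 FQ1 FQ2; apply: nS; exact: FS.
- rewrite map_inj_in_uniq ?filter_uniq ?iota_uniq// => i j.
  by rewrite !mem_filter => /andP[Pi _] /andP[Pj _]; exact: einj.
- exact: sparse_subfamily FS.
Qed.

(** There are [3^n * 2^l] pairs of a family and a [gamma], each contributing at most [bound ^ p] to
    the integral; the final root turns their number into its power [1/p]. *)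
Lemma sparse_domination_bound (C0 : R) (g : fct) (S : 'I_(3 ^ n) -> set (cube R n)) :
  0 < C0 -> p <= 1 -> (forall j, sparse_in_lattice eta (S j)) ->
  {ae mu, forall x, (`|g x|%:E <= C0%:E *
    \sum_(j < 3 ^ n) \sum_(gamma : {ffun 'I_l -> bool}) \esum_(Q in S j)
      (sparse_term gamma Q x * \1_(cube_set Q) x)%:E)%E} ->
  (wLnorm p (fun x => (nu x)%:E) g <=
   (C0 * (3 ^ n * 2 ^ l)%:R `^ p^-1)%:E * bound)%E.
Proof.
move=> C00 p1 spS ae_g.
have /choice[Z ZP] : forall jg : 'I_(3 ^ n) * {ffun 'I_l -> bool},
    exists Z : Rn R n -> \bar R,
    [/\ measurable_fun setT Z, forall x, (0 <= Z x)%E,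
        forall x, ((\esum_(Q in S jg.1) (sparse_term jg.2 Q x * \1_(cube_set Q) x)%:E) `^ p *
          (nu x)%:E <= Z x)%E &
        (\int[mu]_x Z x <= bound `^ p)%E].
  by move=> jg; exact: sparse_family_bound.
have bound0 : (0 <= bound)%E.
  (* Any [gamma] shows that [bmo_star], a maximum started at [-oo], is nonnegative. *)
  have [beta [Bs [be0 Bs0 _ _ prodB]]] := factors_le [ffun=> true].
  rewrite /bound; apply: mule_ge0; last by apply: prode_ge0 => s _; exact: poweR_ge0.
  apply: mule_ge0.
    by rewrite lee_fin; apply: prodr_ge0 => s _; exact: ltW (factor_const_gt0 s).
  by apply: le_trans prodB; rewrite lee_fin; apply: prodr_ge0 => s _; rewrite mulr_ge0.
have Z0 jg x : (0 <= Z jg x)%E by have [] := ZP jg.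
have mZ jg : measurable_fun setT (Z jg) by have [] := ZP jg.
have main : (\int[mu]_x ((`|g x| `^ p)%:E * (nu x)%:E) <=
    (C0 `^ p)%:E * ((3 ^ n * 2 ^ l)%:R%:E * bound `^ p))%E.
  apply: (@le_trans _ _ (\int[mu]_x ((C0 `^ p)%:E * \sum_jg Z jg x))%E).
    apply: ae_le_integral_ge0.
    - by move=> x; rewrite -EFinM lee_fin mulr_ge0 ?powR_ge0 ?nu_ge0.
    - by move=> x; rewrite mule_ge0 ?lee_fin ?powR_ge0// sume_ge0.
    - apply: emeasurable_funM; first exact: measurable_cst.
      by apply: emeasurable_sum => jg _; exact: mZ.
    apply: filterS ae_g => x /= gx.
    rewrite -poweR_EFin; apply: (@le_trans _ _ ((C0%:E `^ p *
      (\sum_jg (\esum_(Q in S jg.1) (sparse_term jg.2 Q x * \1_(cube_set Q) x)%:E) `^ p)) * (nu x)%:E)%E).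
      apply: lee_wpmul2r; first by rewrite lee_fin; exact: nu_ge0.
      have E0 (jg : 'I_(3 ^ n) * {ffun 'I_l -> bool}) :
          (0 <= \esum_(Q in S jg.1) (sparse_term jg.2 Q x * \1_(cube_set Q) x)%:E)%E.
        by apply: esum_ge0 => Q _; rewrite lee_fin mulr_ge0 ?sparse_term_ge0.
      apply: (le_trans (lee_poweR (ltW p_gt0) _ gx)) => //.
      rewrite poweRM ?lee_fin ?(ltW C00)//; last first.
        by apply: sume_ge0 => j _; apply: sume_ge0 => gamma _; exact: (E0 (j, gamma)).
      apply: lee_wpmul2l; first exact: poweR_ge0.
      by rewrite pair_bigA/=; exact: poweR_sum_le.
    rewrite -muleA poweR_EFin; apply: lee_wpmul2l; first by rewrite lee_fin powR_ge0.
    rewrite ge0_sume_distrl; last by move=> jg _; exact: poweR_ge0.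
    by apply: lee_sum => jg _; have [_ _ + _] := ZP jg; exact.
  rewrite ge0_integralZl_EFin; last 4 first.
  - exact: measurableT.
  - by move=> x _; apply: sume_ge0.
  - by apply: emeasurable_sum => jg _; exact: mZ.
  - exact: powR_ge0.
  apply: lee_wpmul2l; first by rewrite lee_fin powR_ge0.
  rewrite ge0_integral_sum; [|exact: measurableT|exact: mZ|by move=> jg x _; exact: Z0].
  apply: (@le_trans _ _ (\sum_(jg : 'I_(3 ^ n) * {ffun 'I_l -> bool}) bound `^ p)%E).
    by apply: lee_sum => jg _; have [] := ZP jg.
  have -> : (\sum_(jg : 'I_(3 ^ n) * {ffun 'I_l -> bool}) bound `^ p =
      (\sum_(jg : 'I_(3 ^ n) * {ffun 'I_l -> bool}) 1%:E) * bound `^ p)%E.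
    by rewrite ge0_sume_distrl//; apply: eq_bigr => jg _; rewrite mul1e.
  rewrite sumEFin sumr_const; apply: lee_wpmul2r; first exact: poweR_ge0.
  by rewrite card_prod card_ord card_ffun card_bool card_ord.
rewrite /wLnorm; apply: (le_trans (lee_poweR _ _ main)).
- by rewrite invr_ge0 ltW.
- by apply: integral_ge0 => x _; rewrite -EFinM lee_fin mulr_ge0 ?powR_ge0 ?nu_ge0.
have K0 : 0 <= (3 ^ n * 2 ^ l)%:R :> R by [].
rewrite -poweR_EFin poweRM ?poweR_ge0//; last by rewrite mule_ge0 ?poweR_ge0// lee_fin.
rewrite poweRM ?poweR_ge0 ?lee_fin// -!poweRrM mulfV ?gt_eqF// !poweRe1// ?lee_fin ?(ltW C00)//.
by rewrite muleA poweR_EFin -EFinM.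
Qed.

End multilinear.

Theorem theorem1p14 (R : realType) (n m l : nat) (n_gt0 : (0 < n)%N)
    (m_ge2 : (2 <= m)%N) (l_ge1 : (1 <= l)%N) (lm : (l <= m)%N)
    (p_ : 'I_m -> R) (p : R)
    (p_gt1 : forall s, 1 < p_ s)
    (pE : p^-1 = \sum_(s < m) (p_ s)^-1)
    (p_gt0 : 0 < p) (p_le1 : p <= 1)
    (C0 eta : R) (C0_gt0 : 0 < C0) (eta_gt0 : 0 < eta) (eta_lt1 : eta < 1) :
  exists2 C : R, 0 < C &
  forall (w : 'I_m -> Rn R n -> R) (b : 'I_l -> Rn R n -> R)
    (D : 'I_m -> set (Rn R n -> R))
    (T : ('I_m -> Rn R n -> R) -> Rn R n -> R),
  (forall s, is_weight (w s)) ->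
  (forall s : 'I_l,
     wBMO (p_ (widen_ord lm s)) (w (widen_ord lm s)) (b s) /\ BMO (b s)) ->
  (forall s g, bounded_compact_support g -> D s g) ->
  (forall (s : 'I_l) g, bounded_compact_support g ->
     D (widen_ord lm s) (fun x => b s x * g x)) ->
  multilinear_on D T ->
  sparse_domination lm C0 eta b (iterated_commutator lm T b) ->
  forall f : 'I_m -> Rn R n -> R, (forall s, bounded_compact_support (f s)) ->
  (wLnorm p (fun x => (\prod_(s < m) w s x `^ (p / p_ s))%:E)
      (iterated_commutator lm T b f)
    <= C%:E * bmo_star lm p_ w b *
       \prod_(s < m) wLnorm (p_ s) (maximal (w s)) (f s))%E.
Proof.
have theta_sum : \sum_s p / p_ s = 1 by rewrite -mulr_sumr -pE mulfV// gt_eqF.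
have count_gt0 : 0 < (3 ^ n * 2 ^ l)%:R :> R.
  by rewrite ltr0n muln_gt0 !expn_gt0.
(* Fixed before the weights and the functions [b_s] are introduced: [factor_const] involves only
   [n], the exponents and [eta]. *)
exists (C0 * (3 ^ n * 2 ^ l)%:R `^ p^-1 * \prod_s factor_const (n := n) p_ eta s).
  rewrite !mulr_gt0 ?powR_gt0//; apply: prodr_gt0 => s _; exact: factor_const_gt0.
move=> w b D T ww wb _ _ _ dom f ff.
have [S [spS ae_T]] := dom f ff.
have := sparse_domination_bound n_gt0 p_gt1 p_gt0 theta_sum eta_gt0 ww wb ff C0_gt0 p_le1 spS ae_T.
by rewrite !muleA -EFinM.
Qed.
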